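(* Let $E\subseteq F$ be smooth countable Borel equivalence relations on a standard Borel space $X$, and $E'\subseteq F'$ smooth countable Borel equivalence relations on a standard Borel space $Y$. Then $(E,F)\sqsubseteq_B(E',F')$ if and only if $\mathrm{gcs}(E,F)\leq\mathrm{gcs}(E',F')$ (i.e., $n_W(E,F)\leq n_W(E',F')$ for every upper set $W$ of $S_c$). In particular, $(E,F)$ and $(E',F')$ are simultaneously Borel biembeddable if and only if $\mathrm{gcs}(E,F)=\mathrm{gcs}(E',F')$.
   Context: A countable Borel equivalence relation on a standard Borel space is a Borel equivalence relation with all classes countable; it is smooth if it admits a Borel reduction to equality on some standard Borel space. $(E,F)\sqsubseteq_B(E',F')$ means there is an injective Borel map $f:X\to Y$ such that for all $x,y$, $x\mathrel{E}y\iff f(x)\mathrel{E'}f(y)$ and $x\mathrel{F}y\iff f(x)\mathrel{F'}f(y)$; biembeddable means such embeddings exist in both directions. For an $F$-class $C$, its local coarse shape is $\mathrm{lcs}(C)=\langle a_m:1\leq m\leq\omega\rangle$ where $a_m$ is the number of $E$-classes contained in $C$ of cardinality at least $m$ (for $m=\omega$: infinite). $S_c$ is the set of all functions $\alpha:\{1,2,\ldots,\omega\}\to\{0,1,\ldots,\omega\}$ that arise as the local coarse shape of some (nonempty) class, i.e., for which there is an equivalence relation on a nonempty countable set having exactly $\alpha(m)$ classes of cardinality at least $m$ for each $m$; it is partially ordered pointwise. An upper set is $W\subseteq S_c$ with $\alpha\in W,\alpha\leq\beta\Rightarrow\beta\in W$. For an upper set $W$, $n_W(E,F)$ is the number of $F$-classes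 $C$ with $\mathrm{lcs}(C)\in W$, and the global coarse shape $\mathrm{gcs}(E,F)$ is the function $W\mapsto n_W(E,F)$ on upper sets. *)

(* Defs.v *)
From mathcomp Require Import all_boot all_order all_algebra.
From mathcomp Require Import all_classical all_reals all_analysis.
From Stdlib Require Export RelationClasses.

Set Implicit Arguments.
Unset Strict Implicit.
Unset Printing Implicit Defensive.

Local Open Scope classical_set_scope.
Local Open Scope card_scope.

(* [measurableType] and [completeType] are pointed in the library; the structures
   below are not, so that the empty standard Borel space is included. *)
Definition polish (R : realType) (M : metricType R) : Prop :=
  (exists2 D : set M, countable D & dense D) /\
  (forall F : set_system M, ProperFilter F -> cauchy F -> exists l : M, F --> l).

Record standardBorelType (R : realType) := StandardBorel {
  sb_sort :> Type ;
  borel : set (set sb_sort) ;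
  borel_polish : exists (M : metricType R) (h : sb_sort -> M),
    [/\ polish M, bijective h &
        forall A : set sb_sort, borel A <-> <<s @open M >> (h @` A)] }.

Arguments borel {R} s.

Section BorelRelations.
Variable R : realType.
Implicit Types X Y : standardBorelType R.

Definition borel_fun X Y (f : X -> Y) : Prop :=
  forall B, borel Y B -> borel X (f @^-1` B).

Definition borel_rel X (E : X -> X -> Prop) : Prop :=
  <<s [set A `*` B | A in borel X & B in borel X] >> [set p | E p.1 p.2].

Definition cber X (E : X -> X -> Prop) : Prop :=
  [/\ Equivalence E, borel_rel E & forall x, countable [set y | E x y]].

Definition smooth X (E : X -> X -> Prop) : Prop :=
  exists (Z : standardBorelType R) (f : X -> Z),
    borel_fun f /\ forall x y, E x y <-> f x = f y.

Definition pair_embeds X Y (E F : X -> X -> Prop) (E' F' : Y -> Y -> Prop) : Prop :=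
  exists f : X -> Y,
    [/\ injective f, borel_fun f,
        forall x y, E x y <-> E' (f x) (f y) &
        forall x y, F x y <-> F' (f x) (f y)].

Definition pair_biembeddable X Y (E F : X -> X -> Prop) (E' F' : Y -> Y -> Prop) :
  Prop := pair_embeds E F E' F' /\ pair_embeds E' F' E F.

End BorelRelations.

(* {0, 1, ..., omega}, with [None] standing for omega. *)
Notation enat := (option nat).

Definition le_enat (m n : enat) : bool :=
  match m, n with
  | _, None => true
  | None, Some _ => false
  | Some i, Some j => (i <= j)%N
  end.

Definition ecard (T : Type) (A : set T) : enat :=
  match pselect (finite_set A) with
  | left finA => Some (sval (cid finA))
  | right _ => None
  end.

(* {1, 2, ..., omega} *)
Definition penat := {m : enat | m != Some 0%N}.

Definition coarse_shape := penat -> enat.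

Definition le_shape (a b : coarse_shape) : Prop := forall m, le_enat (a m) (b m).

Definition classes (T : Type) (E : T -> T -> Prop) : set (set T) :=
  range (fun x => [set y | E x y]).

Definition lcs (T : Type) (E : T -> T -> Prop) (C : set T) : coarse_shape :=
  fun m => ecard [set D | [/\ classes E D, D `<=` C & le_enat (sval m) (ecard D)]].

Definition Sc : set coarse_shape :=
  [set a | exists (T : Type) (E : T -> T -> Prop),
    [/\ countable [set: T], [set: T] !=set0, Equivalence E & a = lcs E setT]].

Definition upper_set (W : set coarse_shape) : Prop :=
  W `<=` Sc /\ forall a b, W a -> Sc b -> le_shape a b -> W b.

(* The number n_W(E, F) is the cardinality of this set, which need not be
   countable; values of n_W are compared by [#<=] and [#=]. *)
Definition shape_classes (T : Type) (E F : T -> T -> Prop) (W : set coarse_shape) :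
    set (set T) :=
  [set C | classes F C /\ W (lcs E C)].

Definition gcs_le (T U : Type) (E F : T -> T -> Prop) (E' F' : U -> U -> Prop) :
  Prop :=
  forall W, upper_set W -> shape_classes E F W #<= shape_classes E' F' W.

Definition gcs_eq (T U : Type) (E F : T -> T -> Prop) (E' F' : U -> U -> Prop) :
  Prop :=
  forall W, upper_set W -> shape_classes E F W #= shape_classes E' F' W.

(* Main.v *)
(** A smooth countable Borel equivalence relation [F] has a Borel numbering of
    the points of each class together with Borel selectors [sg n] (Lusin-Novikov),
    so that the classes of [E] inside a class of [F], their sizes and the local
    coarse shape become Borel data quantified over the natural numbers only.

    Local coarse shapes are non-increasing sequences in [{0, ..., omega}]; there
    are countably many, and they are well-quasi-ordered.  Given [gcs_le], the
    [F]-classes whose shape has only countably many [F']-classes above it are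
    countably many, and are matched injectively with classes of larger shape:
    by the well-quasi-order only finitely many have finitely many candidates
    (Hall's theorem applies to them), and the others are treated greedily.  The
    remaining [F]-classes have above their shape a shape realised by uncountably
    many [F']-classes, whose Borel transversal contains a Cantor set (perfect set
    theorem); these classes are injected there through a Borel reduction of [F]
    to equality.  Inside a pair of matched classes the same greedy matching,
    performed in a Borel way on the [E]-classes labelled by their sizes, yields
    the embedding.

    Lusin-Novikov and the perfect set theorem both follow from one dichotomy for
    a continuous map on a closed subset of Baire space, which rests on the
    separation theorem for analytic sets. *)

Require Import Defs.
From mathcomp Require Import all_boot all_order all_algebra.
From mathcomp Require Import all_classical all_reals all_analysis.
From mathcomp Require Import zify.
From Stdlib Require Cantor.

Set Implicit Arguments.
Unset Strict Implicit.
Unset Printing Implicit Defensive.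

Local Open Scope classical_set_scope.

(** The hypothesis is Hall's condition in disguise: the labels lying above some member of a finite
    set form the upper set generated by it, so [gcs_le] at that upper set bounds the neighbourhood
    from below. Upper sets with several minimal elements matter here. Inside a pair of matched
    classes the labels are sizes, which are linearly ordered; every upper set is then principal and
    [le_shape] is enough. The two parts of the map on classes must not collide. The set [V] of
    shapes with countably many classes above them is an upper set, so partners of shapes in [V] stay
    in [V], while the remaining classes are sent to shapes outside [V]. Such shapes exist because
    there are only countably many shapes in all. Choices made inside a pair of classes have to be
    Borel in the point. They all go through [least] over a countable type, so that each unfolds to
    countable set operations on Borel sets. *)

Section SigmaAlgebra.
Context {T : Type} {S : set (set T)} (sS : sigma_algebra [set: T] S).

Lemma sigma_not (P : T -> Prop) : S [set x | P x] -> S [set x | ~ P x].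
Proof. by case: sS => _ SC _ /SC; rewrite setTD. Qed.

Lemma sigma_cst (P : Prop) : S [set _ | P].
Proof.
have [S0 SC _] := sS; have [p|np] := pselect P.
  by rewrite (_ : [set _ | P] = [set: T] `\` set0);
    [exact: SC|rewrite setD0; apply/seteqP; split].
by rewrite (_ : [set _ | P] = set0) //; apply/seteqP; split.
Qed.

Lemma sigma_exists_in (I : Type) (J : set I) (P : I -> T -> Prop) :
    countable J -> (forall i, J i -> S [set x | P i x]) ->
  S [set x | exists2 i, J i & P i x].
Proof.
move=> /countable_injP[f finj] SP; have [_ _ SU] := sS.
(* [f] is injective on [J], so [Q n] is empty or the set of the single index coded by [n]. *)
pose Q n := [set x | exists i, [/\ J i, f i = n & P i x]].
rewrite (_ : [set x | _] = \bigcup_n Q n); last first.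
  apply/seteqP; split => x /=; first by move=> [i Ji Pix]; exists (f i) => //; exists i.
  by move=> [n _ [i [Ji _ Pix]]]; exists i.
apply: SU => n; rewrite /Q.
have [[i [Ji fin]]|nex] := pselect (exists i, J i /\ f i = n); last first.
  rewrite (_ : [set x | _] = [set _ | False]); first exact: sigma_cst.
  by apply/seteqP; split => x //= -[i [Ji fin _]]; apply: nex; exists i.
rewrite (_ : [set x | _] = [set x | P i x]); first exact: SP.
apply/seteqP; split => x /=; last by exists i.
move=> [j [Jj fjn Pjx]]; suff -> : i = j by [].
by apply: finj; rewrite ?inE // fin fjn.
Qed.

Lemma sigma_exists (I : countType) (P : I -> T -> Prop) :
  (forall i, S [set x | P i x]) -> S [set x | exists i, P i x].
Proof.
move=> SP; rewrite (_ : [set x | _] = [set x | exists2 i, [set: I] i & P i x]).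
  exact: sigma_exists_in.
by apply/seteqP; split => x [i Pi]; exists i.
Qed.

Lemma sigma_forall (I : countType) (P : I -> T -> Prop) :
  (forall i, S [set x | P i x]) -> S [set x | forall i, P i x].
Proof.
move=> SP; rewrite (_ : [set x | _] = [set x | ~ exists i, ~ P i x]).
  by apply/sigma_not/sigma_exists => i; apply/sigma_not.
by apply/seteqP; split => x /= => [Px [i]|/forallNP Px i]; [exact|exact: contrapT].
Qed.

Lemma sigma_or (P Q : T -> Prop) : S [set x | P x] -> S [set x | Q x] ->
  S [set x | P x \/ Q x].
Proof.
move=> SP SQ; rewrite (_ : [set x | _] = [set x | exists b : bool, if b then P x else Q x]).
  by apply: sigma_exists => -[].
apply/seteqP; split => x /= => [[Px|Qx]|[[] Px]]; [by exists true|by exists false|by left|by right].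
Qed.

Lemma sigma_and (P Q : T -> Prop) : S [set x | P x] -> S [set x | Q x] ->
  S [set x | P x /\ Q x].
Proof.
move=> SP SQ; rewrite (_ : [set x | _] = [set x | forall b : bool, if b then P x else Q x]).
  by apply: sigma_forall => -[].
by apply/seteqP; split => x /= => [[Px Qx] []|PQ] //; split; [exact: (PQ true)|exact: (PQ false)].
Qed.

Lemma sigma_imply (P Q : T -> Prop) : S [set x | P x] -> S [set x | Q x] ->
  S [set x | P x -> Q x].
Proof.
move=> SP SQ; rewrite (_ : [set x | _] = [set x | ~ P x \/ Q x]).
  by apply: sigma_or => //; apply: sigma_not.
by apply/seteqP; split => x /= => [PQ|[]//]; have [/PQ|] := pselect (P x); [right|left].
Qed.

Lemma sigma_iff (P Q : T -> Prop) : S [set x | P x] -> S [set x | Q x] ->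
  S [set x | P x <-> Q x].
Proof. by move=> SP SQ; apply: sigma_and; apply: sigma_imply. Qed.

Definition sigma_fun (K : Type) (g : T -> K) := forall k, S [set x | g x = k].

(** Substitutes a measurable index into a family that is measurable for each fixed index, by
    splitting over the countably many values of [g]. Functions built from selectors are handled by
    iterating it. *)
Lemma sigma_fun_comp (K : countType) (g : T -> K) (P : K -> T -> Prop) :
    sigma_fun g -> (forall k, S [set x | P k x]) -> S [set x | P (g x) x].
Proof.
move=> Sg SP; rewrite (_ : [set x | _] = [set x | exists k, g x = k /\ P k x]).
  by apply: sigma_exists => k; apply: sigma_and.
by apply/seteqP; split => x /= => [|[_ [<-]]//]; exists (g x).
Qed.

Lemma sigma_fun_pred (K : countType) (g : T -> K) (P : K -> Prop) :
  sigma_fun g -> S [set x | P (g x)].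
Proof.
by move=> Sg; apply: (@sigma_fun_comp _ g (fun k _ => P k)) => // k; apply: sigma_cst.
Qed.

Lemma sigma_fun_if (K : Type) (P : T -> Prop) (g h : T -> K) :
    S [set x | P x] -> sigma_fun g -> sigma_fun h ->
  sigma_fun (fun x => if pselect (P x) then g x else h x).
Proof.
move=> SP Sg Sh k.
rewrite (_ : [set x | _] = [set x | P x /\ g x = k \/ ~ P x /\ h x = k]).
  by apply: sigma_or; apply: sigma_and => //; apply: sigma_not.
apply/seteqP; split => x /=; case: pselect => Px; [by left|by right|by case=> -[]|by case=> -[]].
Qed.

End SigmaAlgebra.

Lemma smallest_sigma (T : Type) (G : set (set T)) : sigma_algebra [set: T] <<s G >>.
Proof. exact: smallest_sigma_algebra. Qed.

Lemma smallest_sigma_ind (T : Type) (G S : set (set T)) :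
  sigma_algebra [set: T] S -> G `<=` S -> <<s G >> `<=` S.
Proof. by move=> sS GS; apply: smallest_sub. Qed.

Lemma sigma_preimage (T U : Type) (f : T -> U) (S : set (set T)) :
  sigma_algebra [set: T] S -> sigma_algebra [set: U] [set B | S (f @^-1` B)].
Proof.
move=> [S0 SC SU]; split => /=; first by rewrite preimage_set0.
- by move=> A SA; rewrite setTD preimage_setC -setTD; exact: SC.
- by move=> A SA; rewrite preimage_bigcup; exact: SU.
Qed.

(* [least] is minimal for the codes of the countable type, and has the junk value
   [k0] when no element satisfies the predicate. *)
Section Least.
Context {K : countType} (k0 : K).

Definition is_least (P : K -> Prop) (k : K) :=
  P k /\ forall j, P j -> (pickle k <= pickle j)%N.

Definition least (P : K -> Prop) : K := xget k0 [set k | is_least P k].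

Lemma leastP (P : K -> Prop) : (exists k, P k) -> is_least P (least P).
Proof.
move=> [k Pk]; rewrite /least; case: xgetP => [j _ //|] nP; exfalso.
have ex : exists n, `[< exists2 j, P j & pickle j = n >].
  by exists (pickle k); apply/asboolP; exists k.
case: (ex_minnP ex) => n /asboolP[j Pj <-] jmin.
apply: (nP j); split => // i Pi; apply: jmin; apply/asboolP; by exists i.
Qed.

Lemma least_in (P : K -> Prop) : (exists k, P k) -> P (least P).
Proof. by move=> /leastP[]. Qed.

(** [least] comes from a choice operator; this explicit description of its graph is what makes it
    measurable in a parameter. *)
Lemma least_eqE (P : K -> Prop) k :
  least P = k <-> is_least P k \/ (~ exists j, P j) /\ k0 = k.
Proof.
split=> [<-|]; last case.
- have [exP|nP] := pselect (exists j, P j); first by left; apply: leastP.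
  right; split=> //; rewrite /least; case: xgetP => [j _ /= [Pj _]|//].
  by exfalso; apply: nP; exists j.
- move=> [Pk kmin]; have [Pl lmin] := leastP (ex_intro _ k Pk).
  apply: (pcan_inj (@pickleK K)); apply/eqP; rewrite eqn_leq.
  by rewrite lmin // kmin.
- move=> [nP <-]; rewrite /least; case: xgetP => [j _ /= [Pj _]|//].
  by exfalso; apply: nP; exists j.
Qed.

Lemma sigma_least (T : Type) (S : set (set T)) (P : T -> K -> Prop) :
    sigma_algebra [set: T] S -> (forall k, S [set x | P x k]) ->
  sigma_fun (S := S) (fun x => least (P x)).
Proof.
move=> sS SP k; rewrite (_ : [set x | _] =
    [set x | is_least (P x) k \/ (~ exists j, P x j) /\ k0 = k]).
  apply: sigma_or => //; apply: sigma_and => //.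
  - by apply: sigma_forall => // j; apply: sigma_imply => //; apply: sigma_cst.
  - by apply: sigma_not => //; apply: sigma_exists.
  - exact: sigma_cst.
by apply/seteqP; split => x /=; rewrite least_eqE.
Qed.

End Least.

(** * Baire space *)

Notation baire := (nat -> nat).

Section Agree.
Context {A : Type}.
Implicit Types x y z : nat -> A.

Definition agree n x y := forall i, (i < n)%N -> x i = y i.

Lemma agree_sym n x y : agree n x y -> agree n y x.
Proof. by move=> xy i /xy. Qed.

Lemma agree_trans n y x z : agree n x y -> agree n y z -> agree n x z.
Proof. by move=> xy yz i lin; rewrite xy // yz. Qed.

Lemma agree_le m n x y : (m <= n)%N -> agree n x y -> agree m x y.
Proof. by move=> mn xy i im; apply: xy; apply: leq_trans mn. Qed.

Lemma agree_pre n x y : agree n x y <-> mkseq x n = mkseq y n.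
Proof.
split=> [xy|xy i lin]; first by apply/eq_in_map => i; rewrite mem_iota => /xy.
by rewrite -(nth_mkseq (x i) x lin) xy nth_mkseq.
Qed.

Lemma agree_all x y : (forall n, agree n x y) -> x = y.
Proof. by move=> xy; apply/funext => n; apply: (xy n.+1). Qed.

Lemma agree_neq x y : x <> y -> exists n, ~ agree n x y.
Proof. by move=> xy; apply/existsNP => /agree_all. Qed.

(** Coordinate [i] is settled from stage [i+1] on, since [m (i+1) > i]; the diagonal [y i.+1 i] is
    therefore the limit of the sequence. *)
Lemma agree_limit (m : nat -> nat) (y : nat -> nat -> A) :
    (forall k, (k <= m k)%N) -> (forall k, (m k <= m k.+1)%N) ->
    (forall k, agree (m k) (y k) (y k.+1)) ->
  forall k, agree (m k) (fun i => y i.+1 i) (y k).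
Proof.
move=> mk mS ym.
have mono k d : (m k <= m (k + d))%N.
  by elim: d => [|d ih]; rewrite ?addn0 // addnS (leq_trans ih).
have step k d : agree (m k) (y k) (y (k + d)).
  elim: d => [|d ih]; rewrite ?addn0 // addnS.
  by apply: (agree_trans ih); apply: (agree_le _ (ym _)).
move=> k i ik; case: (leqP k i.+1) => ki.
  by rewrite -(subnKC ki) -step.
by rewrite -[in RHS](subnKC (ltnW ki)) -step.
Qed.

Lemma agree_dependent_choice (x0 : nat -> A) (Q : nat -> (nat -> A) -> Prop) :
    Q 0%N x0 ->
    (forall n x, Q n x -> exists2 y, agree n x y & Q n.+1 y) ->
  exists x, forall n, exists2 y, agree n x y & Q n y.
Proof.
move=> Q0 Qs.
have /choice[f fP] : forall p : nat * (nat -> A), exists y,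
    Q p.1 p.2 -> agree p.1 p.2 y /\ Q p.1.+1 y.
  by move=> [n x] /=; have [/Qs[y xy Qy]|nQ] := pselect (Q n x); [exists y|exists x].
pose y := fix y n := if n is k.+1 then f (k, y k) else x0.
have Qy n : Q n (y n) by elim: n => // n ih /=; have [] := fP (n, y n) ih.
have yS n : agree n (y n) (y n.+1) by have [] := fP (n, y n) (Qy n).
exists (fun i => y i.+1 i) => n; exists (y n) => //.
exact: (agree_limit (m := id)).
Qed.

End Agree.

(** Continuity for products of discrete spaces, with [agree n] as basic neighbourhoods; [closedB]
    refers to the same topology. *)
Definition contB (A B : Type) (f : (nat -> A) -> (nat -> B)) :=
  forall x i, exists k, forall y, agree k x y -> f x i = f y i.

Definition closedB (A : Type) (D : set (nat -> A)) :=
  forall x, (forall n, exists2 y, agree n x y & D y) -> D x.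

Section ContinuousMaps.
Context {A B : Type}.

Lemma contB_agree (f : (nat -> A) -> (nat -> B)) x n : contB f ->
  exists k, forall y, agree k x y -> agree n (f x) (f y).
Proof.
move=> cf; elim: n => [|n [k kP]]; first by exists 0%N.
have [l lP] := cf x n; exists (maxn k l) => y xy i; rewrite ltnS leq_eqVlt.
case/orP => [/eqP ->|lin]; first by apply: lP; apply: agree_le xy; apply: leq_maxr.
by apply: kP => //; apply: agree_le xy; apply: leq_maxl.
Qed.

Lemma closedB_bigcap (I : Type) (D : I -> set (nat -> A)) :
  (forall i, closedB (D i)) -> closedB [set x | forall i, D i x].
Proof. by move=> cD x Dx i; apply: cD => n; have [y xy /(_ i)] := Dx n; exists y. Qed.

Lemma closedB_and (D E : set (nat -> A)) :
  closedB D -> closedB E -> closedB [set x | D x /\ E x].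
Proof.
by move=> cD cE x DEx; split; [apply: cD|apply: cE] => n; have [y xy []] := DEx n; exists y.
Qed.

Lemma closedB_eq (f g : (nat -> A) -> (nat -> B)) :
  contB f -> contB g -> closedB [set x | f x = g x].
Proof.
move=> cf cg x fgx; apply/funext => i.
have [k kP] := cf x i; have [l lP] := cg x i.
have [y xy /= fgy] := fgx (maxn k l).
rewrite (kP y) ?(lP y) ?fgy //; apply: agree_le xy; [exact: leq_maxr|exact: leq_maxl].
Qed.

Lemma closedB_preimage (f : (nat -> A) -> (nat -> B)) (D : set (nat -> B)) :
  contB f -> closedB D -> closedB [set x | D (f x)].
Proof.
move=> cf cD x Dx; apply: cD => n; have [k kP] := contB_agree x n cf.
by have [y xy Dy] := Dx k; exists (f y) => //; apply: kP.
Qed.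

End ContinuousMaps.

Lemma contB_comp (A B C : Type) (f : (nat -> A) -> (nat -> B)) (g : (nat -> B) -> (nat -> C)) :
  contB f -> contB g -> contB (fun x => g (f x)).
Proof.
move=> cf cg x i; have [k kP] := cg (f x) i; have [l lP] := contB_agree x k cf.
by exists l => y xy; apply: kP; apply: lP.
Qed.

Lemma contB_id (A : Type) : contB (fun x : nat -> A => x).
Proof. by move=> x i; exists i.+1 => y; apply. Qed.

(** With [cols], identifies Baire space with its countable power, so that one point can carry a
    sequence of witnesses. *)
Definition col (n : nat) (z : baire) : baire := fun k => z (Cantor.to_nat (n, k)).

Definition cols (w : nat -> baire) : baire := fun j => let: (n, k) := Cantor.of_nat j in w n k.

Lemma colK w n : col n (cols w) = w n.
Proof. by apply/funext => k; rewrite /col /cols Cantor.cancel_of_to. Qed.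

Lemma col_inj z z' : (forall n, col n z = col n z') -> z = z'.
Proof.
move=> zz; apply/funext => j; rewrite -(Cantor.cancel_to_of j).
case: (Cantor.of_nat j) => n k; exact: (congr1 (fun f => f k) (zz n)).
Qed.

Lemma contB_col n : contB (col n).
Proof. by move=> x i; exists (Cantor.to_nat (n, i)).+1 => y; apply. Qed.

Definition shift (z : baire) : baire := fun k => z k.+1.

Definition ncons (n : nat) (z : baire) : baire := fun k => if k is l.+1 then z l else n.

Lemma shiftK n z : shift (ncons n z) = z. Proof. by apply/funext. Qed.

Lemma shift_inj z z' : z 0%N = z' 0%N -> shift z = shift z' -> z = z'.
Proof. by move=> z0 zS; apply/funext => -[//|k]; exact: (congr1 (fun f => f k) zS). Qed.

Lemma agree_shift (n : nat) (z z' : baire) : agree n.+1 z z' -> agree n (shift z) (shift z').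
Proof. by move=> zz i lin; apply: zz. Qed.

(** * Borel and analytic subsets of Baire space *)

Definition borelB : set (set baire) := <<s [set A | exists i j, A = [set x | x i = j]] >>.

Lemma borelB_sigma : sigma_algebra [set: baire] borelB.
Proof. exact: smallest_sigma. Qed.
#[local] Hint Resolve borelB_sigma : core.

Lemma borelB_coord i j : borelB [set x | x i = j].
Proof. by apply: sub_gen_smallest; exists i, j. Qed.

Lemma borelB_agree n y : borelB [set x | agree n x y].
Proof.
apply: (sigma_forall borelB_sigma) => i.
apply: (sigma_imply borelB_sigma); first exact: sigma_cst.
exact: borelB_coord.
Qed.

Lemma sigma_borelB (T : Type) (S : set (set T)) (f : T -> baire) :
    sigma_algebra [set: T] S -> (forall i j, S [set x | f x i = j]) ->
  forall B, borelB B -> S (f @^-1` B).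
Proof.
move=> sS Sf B; apply: (@smallest_sigma_ind _ _ [set B | S (f @^-1` B)]).
  exact: sigma_preimage.
by move=> _ [i [j ->]]; apply: Sf.
Qed.

Lemma contB_borelB_coord (A : countType) (f : (nat -> A) -> baire) (S : set (set (nat -> A))) :
    sigma_algebra [set: nat -> A] S -> (forall i j, S [set x | x i = j]) ->
    contB f -> forall i j, S [set x | f x i = j].
Proof.
(* A value [f x i] is decided by a finite prefix [s] of [x], and there are countably many
   prefixes. *)
move=> sS Sc cf i j; rewrite (_ : [set x | _] = [set x | exists s : seq A,
    (forall y, mkseq y (size s) = s -> f y i = j) /\ mkseq x (size s) = s]).
  apply: (sigma_exists sS) => s; apply: (sigma_and sS); first exact: sigma_cst.
  (* [onth] states the equality coordinatewise without a default element of [A]. *)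
  rewrite (_ : [set x | _] = [set x | forall k, (k < size s)%N -> Some (x k) = onth s k]).
    apply: (sigma_forall sS) => k; apply: (sigma_imply sS); first exact: sigma_cst.
    case: (onth s k) => [a|].
      rewrite (_ : [set x | _] = [set x | x k = a]) //.
      by apply/seteqP; split => x /= => [[]|->].
    rewrite (_ : [set x | _] = [set _ | False]); first exact: sigma_cst.
    by apply/seteqP; split.
  apply/seteqP; split => x /= => [xs k ks|xs].
    by rewrite -[in RHS]xs onthE (nth_map (x k)) ?size_mkseq // nth_mkseq.
  case: s xs => // a s xs; apply: (@eq_from_nth _ a); rewrite size_mkseq // => k ks.
  by rewrite nth_mkseq //; have := xs k ks; rewrite onthE (nth_map a) // => -[].
apply/seteqP; split => x /= => [<-|[s [fs xs]]]; last exact: fs.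
have [k kP] := cf x i; exists (mkseq x k); rewrite size_mkseq; split => // y yx.
by apply/esym/kP/agree_pre.
Qed.

Lemma contB_borelB (f : baire -> baire) B : contB f -> borelB B -> borelB [set x | B (f x)].
Proof.
move=> cf; apply: (sigma_borelB (f := f)) => // i j.
by apply: contB_borelB_coord => // *; apply: borelB_coord.
Qed.

Lemma borelB_and A B : borelB A -> borelB B -> borelB (A `&` B).
Proof. exact: sigma_and. Qed.

Lemma borelB_bigcup (A : nat -> set baire) :
  (forall n, borelB (A n)) -> borelB [set x | exists n, A n x].
Proof. exact: sigma_exists. Qed.

Definition presents (D : set baire) (phi : baire -> baire) (A : set baire) :=
  [/\ closedB D, contB phi & A = phi @` D].

Definition analytic (A : set baire) := exists D phi, presents D phi A.

(** Injectivity is recorded because injective images of Borel sets are reduced to injective images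
    of closed sets by composing with [phi]. *)
Definition inj_presents D phi A := presents D phi A /\ {in D &, injective phi}.

Lemma set_injP (T U : Type) (D : set T) (f : T -> U) :
  {in D &, injective f} <-> forall x y, D x -> D y -> f x = f y -> x = y.
Proof.
split=> [fi x y Dx Dy|fi x y]; first by apply: fi; rewrite inE.
by rewrite !inE; apply: fi.
Qed.

Section PresentFamily.
Variables (D : nat -> set baire) (phi : nat -> baire -> baire) (A : nat -> set baire).
Hypothesis DA : forall n, presents (D n) (phi n) (A n).

(** Fibre product: the columns of [z] are witnesses for all the [A n] with one common image. *)
Definition bigcap_dom : set baire :=
  [set z | forall n, D n (col n z) /\ phi n (col n z) = phi 0%N (col 0%N z)].

Lemma presents_bigcap : presents bigcap_dom (fun z => phi 0%N (col 0%N z)) [set x | forall n, A n x].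
Proof.
have cphi n : contB (fun z => phi n (col n z)).
  by apply: contB_comp (@contB_col n) _; case: (DA n).
split=> //.
- apply: closedB_bigcap => n; apply: closedB_and; last exact: closedB_eq.
  by apply: closedB_preimage; [exact: contB_col|case: (DA n)].
- apply/seteqP; split => x /=.
    move=> Ax; have /choice[w wP] : forall n, exists w, D n w /\ phi n w = x.
      by move=> n; have := Ax n; have [_ _ ->] := DA n => -[w]; exists w.
    by exists (cols w); [move=> n|]; rewrite !colK; case: (wP 0%N) => // ? ->; case: (wP n).
  move=> [z zD <-] n; have [_ _ ->] := DA n; have [Dz <-] := zD n.
  by exists (col n z).
Qed.

(** Disjoint sum: coordinate 0 names the summand and the shifted sequence is the witness in it. *)
Definition bigcup_dom : set baire := [set z | D (z 0%N) (shift z)].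

Lemma presents_bigcup : presents bigcup_dom (fun z => phi (z 0%N) (shift z)) [set x | exists n, A n x].
Proof.
split.
- move=> z zD; rewrite /bigcup_dom /=; have [cD _ _] := DA (z 0%N); apply: cD => n.
  have [y' zy' Dy'] := zD n.+1; exists (shift y'); first exact: agree_shift.
  by move: Dy'; rewrite /bigcup_dom /= -(zy' 0%N).
- move=> z i; have [_ cphi _] := DA (z 0%N); have [k kP] := cphi (shift z) i.
  by exists k.+1 => y zy; rewrite -(zy 0%N) //; apply: kP; apply: agree_shift.
- apply/seteqP; split => x /= => [[n]|[z zD <-]].
    have [_ _ ->] := DA n => -[w Dw <-]; exists (ncons n w); rewrite /bigcup_dom /= ?shiftK //.
  by exists (z 0%N); have [_ _ ->] := DA (z 0%N); exists (shift z).
Qed.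

Hypothesis phi_inj : forall n, {in D n &, injective (phi n)}.

Lemma inj_presents_bigcap :
  inj_presents bigcap_dom (fun z => phi 0%N (col 0%N z)) [set x | forall n, A n x].
Proof.
split; [exact: presents_bigcap|apply/set_injP => z z' zD zD' zz].
apply: col_inj => n; have [Dn en] := zD n; have [Dn' en'] := zD' n.
by move/set_injP: (@phi_inj n); apply => //; rewrite en en'.
Qed.

Lemma inj_presents_bigcup : (forall n m x, A n x -> A m x -> n = m) ->
  inj_presents bigcup_dom (fun z => phi (z 0%N) (shift z)) [set x | exists n, A n x].
Proof.
move=> disj; split; [exact: presents_bigcup|apply/set_injP => z z' zD zD' zz].
have AD t : bigcup_dom t -> A (t 0%N) (phi (t 0%N) (shift t)).
  by move=> tD; have [_ _ ->] := DA (t 0%N); exists (shift t).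
have z0 : z 0%N = z' 0%N by apply: disj (AD _ zD) _; rewrite zz; apply: AD.
apply: shift_inj => //; move/set_injP: (@phi_inj (z 0%N)); apply => //.
  by rewrite z0.
by rewrite zz z0.
Qed.

End PresentFamily.

Definition inj_image A := exists D phi, inj_presents D phi A.

Lemma inj_image_bigcap (A : nat -> set baire) :
  (forall n, inj_image (A n)) -> inj_image [set x | forall n, A n x].
Proof.
move=> /choice[D] /choice[phi] DA.
by eexists; eexists; apply: (inj_presents_bigcap (D := D) (phi := phi)) => n; have [] := DA n.
Qed.

Lemma inj_image_bigcup (A : nat -> set baire) :
    (forall n m x, A n x -> A m x -> n = m) ->
  (forall n, inj_image (A n)) -> inj_image [set x | exists n, A n x].
Proof.
move=> disj /choice[D] /choice[phi] DA.
by eexists; eexists; apply: (inj_presents_bigcup (D := D) (phi := phi)) => // n; have [] := DA n.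
Qed.

Lemma inj_image_closed A : closedB A -> inj_image A.
Proof.
by move=> cA; exists A, id; split; [split=> //; [exact: contB_id|rewrite image_id]|move=> ?].
Qed.

Lemma inj_image_clopen (P : baire -> Prop) i :
  (forall x y, x i = y i -> P x -> P y) -> inj_image [set x | P x].
Proof.
move=> Pi; apply: inj_image_closed => x xP; have [y xy] := xP i.+1.
by apply: Pi; apply/esym/xy.
Qed.

(** Complements are carried along so that the sets in question form a sigma-algebra. *)
Lemma borelB_inj_image A : borelB A -> inj_image A.
Proof.
suff : borelB `<=` [set A | inj_image A /\ inj_image (~` A)] by move=> /[apply] -[].
move=> {A}; apply: smallest_sigma_ind; last first.
  by move=> _ [i [j ->]]; split; apply: (@inj_image_clopen _ i) => x y /= ->.
have inj_image0 : inj_image set0 by apply: (@inj_image_clopen _ 0%N) => x y.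
split => /=.
- by split => //; rewrite setC0; apply: inj_image_closed.
- by move=> A [iA iCA]; rewrite setTD setCK.
- move=> A iA; split; last first.
    rewrite setC_bigcup (_ : \bigcap_(i in _) _ = [set x | forall n, (~` A n) x]).
      by apply: inj_image_bigcap => n; case: (iA n).
    by apply/seteqP; split => x /= Ax n => [|_]; apply: Ax.
  (* The union is made disjoint, as [inj_image_bigcup] demands: the piece [n] consists of the points
     whose first index is [n], written as a countable intersection. *)
  rewrite (_ : \bigcup_n A n =
    [set x | exists n, [set x | forall k, [set x | if (k < n)%N then ~ A k x else A n x] x] x]).
    apply: inj_image_bigcup => [n m x /= An Am|n].
      have := An m; have := Am n; have := An n; have := Am m; rewrite !ltnn.
      by case: (ltngtP n m) => // ? ? ? ? ?.
    by apply: inj_image_bigcap => k; case: (k < n)%N; [case: (iA k)|case: (iA n)].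
  apply/seteqP; split => x /= => [[n _ Anx]|[n /(_ n) /=]]; last by rewrite ltnn; exists n.
  have ex : exists n, `[< A n x >] by exists n; apply/asboolP.
  case: (ex_minnP ex) => m /asboolP Amx mmin; exists m => k; case: ltnP => // km Akx.
  by have := mmin k; rewrite leqNgt km => /(_ (asboolT Akx)).
Qed.

Lemma borelB_analytic A : borelB A -> analytic A.
Proof. by move=> /borelB_inj_image[D [phi [DA _]]]; exists D, phi. Qed.

Lemma closedB_analytic A : closedB A -> analytic A.
Proof. by move=> /inj_image_closed[D [phi [DA _]]]; exists D, phi. Qed.

Lemma analytic_bigcap (A : nat -> set baire) :
  (forall n, analytic (A n)) -> analytic [set x | forall n, A n x].
Proof.
move=> /choice[D] /choice[phi] DA; eexists; eexists.
exact: (presents_bigcap (D := D) (phi := phi)).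
Qed.

Lemma analytic_bigcup (A : nat -> set baire) :
  (forall n, analytic (A n)) -> analytic [set x | exists n, A n x].
Proof.
move=> /choice[D] /choice[phi] DA; eexists; eexists.
exact: (presents_bigcup (D := D) (phi := phi)).
Qed.

Lemma analytic_and (A B : set baire) :
  analytic A -> analytic B -> analytic [set x | A x /\ B x].
Proof.
move=> aA aB; rewrite (_ : [set x | _] =
    [set x | forall n, [set x | if n is 0 then A x else B x] x]).
  by apply: analytic_bigcap => -[].
by apply/seteqP; split => x /= => [[Ax Bx] []|AB] //; split; [exact: (AB 0%N)|exact: (AB 1%N)].
Qed.

Lemma analytic_exists (I : countType) (A : I -> set baire) :
  (forall i, analytic (A i)) -> analytic [set x | exists i, A i x].
Proof.
move=> aA; rewrite (_ : [set x | _] =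
    [set x | exists n, [set x | if unpickle n is Some i then A i x else False] x]).
  apply: analytic_bigcup => n; case: (unpickle n) => [i|]; first exact: aA.
  exact: (borelB_analytic (sigma_cst borelB_sigma False)).
apply/seteqP; split => x /= => [[i Ai]|[n]]; first by exists (pickle i); rewrite pickleK.
by case: (unpickle n) => // i; exists i.
Qed.

Lemma analytic_image (f : baire -> baire) A : contB f -> analytic A -> analytic (f @` A).
Proof.
move=> cf [D [phi [cD cphi ->]]]; exists D, (fun x => f (phi x)); split => //.
  exact: contB_comp cphi cf.
by rewrite image_comp.
Qed.

Lemma analytic_preimage (f : baire -> baire) A :
  contB f -> analytic A -> analytic [set x | A (f x)].
Proof.
move=> cf [D [phi [cD cphi ->]]].
exists [set z | D (col 1 z) /\ phi (col 1 z) = f (col 0 z)], (col 0); split.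
- apply: closedB_and; first by apply: closedB_preimage cD; apply: contB_col.
  by apply: closedB_eq; [apply: contB_comp cphi|apply: contB_comp cf]; apply: contB_col.
- exact: contB_col.
- apply/seteqP; split => x /= => [[w Dw wx]|[z [Dz ez] <-]]; last by exists (col 1 z).
  by exists (cols (fun n => if n is 0 then x else w)); rewrite !colK.
Qed.

(** * Separation and the Lusin-Souslin theorem *)

Definition separated (P Q : set baire) :=
  exists2 S, borelB S & P `<=` S /\ Q `<=` ~` S.

(** Used in contrapositive form: if two countable unions cannot be separated, neither can some pair
    of pieces, so inseparability descends to longer cylinders. *)
Lemma separated_bigcup (P Q : nat -> set baire) :
    (forall i j, separated (P i) (Q j)) ->
  separated [set x | exists i, P i x] [set x | exists j, Q j x].
Proof.
move=> sPQ; have /choice[S SP] : forall p : nat * nat, exists S : set baire,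
    [/\ borelB S, P p.1 `<=` S & Q p.2 `<=` ~` S].
  by move=> [i j]; have [S bS [PS QS]] := sPQ i j; exists S.
exists [set x | exists i, forall j, S (i, j) x].
  apply: (sigma_exists borelB_sigma) => i; apply: (sigma_forall borelB_sigma) => j.
  by have [] := SP (i, j).
split=> x [i].
  by move=> Pix; exists i => j; have [_ + _] := SP (i, j); apply.
by move=> Qix [k /(_ i)]; have [_ _ /(_ _ Qix)] := SP (k, i).
Qed.

Lemma separated_sub P Q P' Q' : P' `<=` P -> Q' `<=` Q -> separated P Q -> separated P' Q'.
Proof.
move=> P'P Q'Q [S bS [PS QS]]; exists S => //.
by split; [apply: subset_trans PS|apply: subset_trans QS].
Qed.

Definition set_coord (n i : nat) (x : baire) : baire := fun k => if k == n then i else x k.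

Lemma agree_set_coord n x y : agree n x y -> agree n.+1 (set_coord n (y n) x) y.
Proof.
move=> xy i; rewrite ltnS leq_eqVlt /set_coord; case: eqP => [-> //|_ /= lin].
exact: xy.
Qed.

Definition cyl (D : set baire) n (x : baire) : set baire := [set y | D y /\ agree n x y].

Theorem analytic_separation A B : analytic A -> analytic B -> A `&` B = set0 -> separated A B.
Proof.
move=> [D [phi [cD cphi ->]]] [E [psi [cE cpsi ->]]] disj; apply: contrapT => nsep.
(* [z] carries a branch of each domain at once; [Q n] says that the images of the cylinders of
   length [n] around them are inseparable. *)
pose Q n (z : nat -> nat * nat) :=
  ~ separated (phi @` cyl D n (fst \o z)) (psi @` cyl E n (snd \o z)).
have [||z zQ] := @agree_dependent_choice _ (fun _ => (0, 0)%N) Q.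
- by apply: contra_not nsep; apply: separated_sub => _ [x Dx <-]; exists x.
- move=> n z nz; apply: contrapT => /forall2NP nQ; apply: nz.
  pose P i := phi @` cyl D n.+1 (set_coord n i (fst \o z)).
  pose P' j := psi @` cyl E n.+1 (set_coord n j (snd \o z)).
  apply: (@separated_sub [set x | exists i, P i x] [set x | exists j, P' j x]).
  + move=> _ [x [Dx zx] <-]; exists (x n), x => //; split=> //.
    exact: agree_set_coord.
  + move=> _ [x [Dx zx] <-]; exists (x n), x => //; split=> //.
    exact: agree_set_coord.
  + apply: separated_bigcup => i j.
    pose z' k := if k == n then (i, j) else z k.
    case: (nQ z') => [[]|/contrapT].
      by move=> k kn; rewrite /z' ltn_eqF.
    rewrite (_ : fst \o z' = set_coord n i (fst \o z)); last first.
      by apply/funext => k; rewrite /set_coord /= /z'; case: eqP.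
    rewrite (_ : snd \o z' = set_coord n j (snd \o z)) //.
    by apply/funext => k; rewrite /set_coord /= /z'; case: eqP.
- have {}zQ n : Q n z.
    have [y zy] := zQ n; apply: contra_not; apply: separated_sub.
      move=> _ [x [Dx zx] <-]; exists x => //; split=> //.
      by apply: agree_trans zx => i lin /=; rewrite zy.
    move=> _ [x [Dx zx] <-]; exists x => //; split=> //.
    by apply: agree_trans zx => i lin /=; rewrite zy.
  (* An empty cylinder would be separated trivially, so the branches lie in the closed domains. *)
  have Dz : D (fst \o z).
    apply: cD => n; apply: contrapT => /forall2NP nD; apply: (zQ n).
    exists set0; first exact: (sigma_cst borelB_sigma False).
    by split=> [y [x [Dx zx] _]|y _ []]; case: (nD x).
  have Ez : E (snd \o z).
    apply: cE => n; apply: contrapT => /forall2NP nD; apply: (zQ n).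
    exists setT; first exact: (sigma_cst borelB_sigma True).
    by split=> // y [x [Dx zx] _]; case: (nD x).
  have /eqP neq : phi (fst \o z) <> psi (snd \o z).
    move=> e; suff : set0 (phi (fst \o z)) by [].
    by rewrite -disj; split; [exists (fst \o z)|exists (snd \o z)].
  have [i] : exists i, phi (fst \o z) i <> psi (snd \o z) i.
    by apply/existsNP => e; move/eqP: neq; apply; apply/funext.
  have [k kP] := cphi (fst \o z) i; have [l lP] := cpsi (snd \o z) i => neqi.
  (* By continuity the value at coordinate [i] already separates the images of long cylinders. *)
  apply: (zQ (maxn k l)).
  exists [set x | x i = phi (fst \o z) i]; first exact: borelB_coord.
  split=> _ [x [_ zx] <-] /=.
    by rewrite (kP x) //; apply: agree_le zx; apply: leq_maxl.
  rewrite -(lP x); first exact: nesym.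
  by apply: agree_le zx; apply: leq_maxr.
Qed.

Lemma analytic_separation_family (I : countType) (A : I -> set baire) :
    (forall i, analytic (A i)) -> (forall i j x, A i x -> A j x -> i = j) ->
  exists B : I -> set baire, [/\ forall i, borelB (B i), forall i, A i `<=` B i &
    forall i j x, B i x -> B j x -> i = j].
Proof.
move=> aA dA; have /choice[S SP] : forall p : I * I, exists S : set baire, p.1 <> p.2 ->
    [/\ borelB S, A p.1 `<=` S & A p.2 `<=` ~` S].
  move=> [i j] /=; have [->|nij] := eqVneq i j; first by exists set0.
  have [|S bS [AS AS']] := analytic_separation (aA i) (aA j).
    by apply/seteqP; split => x // -[Ai Aj]; move/eqP: nij; apply; apply: dA Ai Aj.
  by exists S.
(* Both orders of a pair are used: for distinct indices, [B i] lies in [S (i, j)] and [B j] in its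
   complement. *)
pose B i := [set x | forall j, i <> j -> S (i, j) x /\ ~ S (j, i) x].
exists B; split => [i|i x Ai j nij|i j x Bi Bj].
- apply: (sigma_forall borelB_sigma) => j.
  have [-> |nij] := pselect (i = j).
    rewrite (_ : [set x | _] = [set _ | True]); first exact: sigma_cst.
    by apply/seteqP; split => x /=.
  apply: (sigma_imply borelB_sigma); first exact: sigma_cst.
  apply: (sigma_and borelB_sigma); first by have [] := SP (i, j) nij.
  by apply: (sigma_not borelB_sigma); have [] := SP (j, i) (nesym nij).
- have [_ AS _] := SP (i, j) nij; have [_ _ AS'] := SP (j, i) (nesym nij).
  by split; [exact: AS|exact: AS'].
- by apply: contrapT => nij; have [Sij _] := Bi _ nij; have [_ ] := Bj _ (nesym nij).
Qed.

Lemma analytic_cyl D n x : analytic D -> analytic (cyl D n x).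
Proof.
move=> aD; apply: analytic_and => //; apply: borelB_analytic.
rewrite (_ : agree n x = [set y | agree n y x]); first exact: borelB_agree.
by apply/seteqP; split => y /agree_sym.
Qed.

Definition closureB (A : set baire) : set baire :=
  [set x | forall n, exists2 y, agree n x y & A y].

Lemma borelB_closureB A : borelB (closureB A).
Proof.
apply: (sigma_forall borelB_sigma) => n.
rewrite (_ : [set x | _] = [set x | exists s : seq nat,
    (exists2 y, A y & mkseq y n = s) /\ agree n x (nth 0%N s)]).
  apply: (sigma_exists borelB_sigma) => s; apply: (sigma_and borelB_sigma).
    exact: sigma_cst.
  exact: borelB_agree.
apply/seteqP; split => x /= => [[y xy Ay]|[_ [[y Ay <-] xy]]].
  exists (mkseq y n); split; first by exists y.
  by apply: agree_trans xy _ => i lin; rewrite nth_mkseq.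
by exists y => //; apply: agree_trans xy _ => i lin; rewrite nth_mkseq.
Qed.

(** Images of distinct cylinders of one length are disjoint analytic sets, hence lie in disjoint
    Borel sets. This replaces the quantifier over branches, a projection, by a countable union at
    each length. *)
Theorem lusin_souslin (D : set baire) (q : baire -> baire) :
  closedB D -> contB q -> {in D &, injective q} -> borelB (q @` D).
Proof.
move=> cD cq /set_injP qi.
pose A (s : seq nat) := q @` [set x | D x /\ mkseq x (size s) = s].
have /choice[B BP] : forall k, exists B : seq nat -> set baire,
    [/\ forall s, borelB (B s), forall s, size s = k -> A s `<=` B s &
        forall s t x, size s = k -> size t = k -> B s x -> B t x -> s = t].
  move=> k; pose Ak s := if size s == k then A s else set0.
  have [s|s t x|B [bB AB dB]] := @analytic_separation_family _ Ak.
  - rewrite /Ak; case: eqP => _; last exact: (borelB_analytic (sigma_cst borelB_sigma False)).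
    apply: analytic_image => //; apply: analytic_and; first exact: closedB_analytic.
    apply: borelB_analytic; rewrite (_ : (fun x => _) = [set x | agree (size s) x (nth 0%N s)]).
      exact: borelB_agree.
    have es : mkseq (nth 0%N s) (size s) = s by rewrite mkseq_nth.
    by apply/seteqP; split => x /=; rewrite agree_pre es.
  - rewrite /Ak; do 2![case: eqP => // ?] => -[y [Dy ys] <-] [z [Dz zt]] /esym/qi.
    by move=> /(_ Dy Dz) yz; rewrite -ys -zt yz; congr mkseq; congruence.
  - by exists B; split => // [s sk|s t x _ _]; [have := AB s; rewrite /Ak sk eqxx|exact: dB].
(* All prefixes are tested so that the sequences found at different lengths cohere; the closure
   makes points of the image approach [x]. *)
pose G j s x := B j (take j s) x /\ closureB (A (take j s)) x.
rewrite (_ : q @` D = [set x | forall k, exists s : seq nat, size s = k /\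
    forall j, (j <= k)%N -> G j s x]).
  apply: (sigma_forall borelB_sigma) => k; apply: (sigma_exists borelB_sigma) => s.
  apply: (sigma_and borelB_sigma); first exact: sigma_cst.
  apply: (sigma_forall borelB_sigma) => j; apply: (sigma_imply borelB_sigma); first exact: sigma_cst.
  have [bB _ _] := BP j; rewrite /G.
  by apply: (sigma_and borelB_sigma); [exact: bB|exact: borelB_closureB].
apply/seteqP; split => y.
  move=> [x Dx <-] k; exists (mkseq x k); split; first by rewrite size_mkseq.
  move=> j jk; have tj : take j (mkseq x k) = mkseq x j.
    by rewrite /mkseq -map_take take_iota (minn_idPl jk).
  have Aj : A (mkseq x j) (q x) by exists x => //; rewrite size_mkseq.
  rewrite /G tj; split; first by have [_ + _] := BP j; apply; rewrite ?size_mkseq.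
  by move=> n; exists (q x).
(* Conversely, disjointness of the [B k] assembles the sequences [s k] into one branch. *)
move=> /choice[s sP]; have szs k : size (s k) = k by have [] := sP k.
have sS k : take k (s k.+1) = s k.
  have [_ _ dB] := BP k; apply: (dB _ _ y); rewrite ?size_take ?szs ?ltnSn //.
    by have [_ /(_ k (leqnSn k)) []] := sP k.+1.
  by have [_ /(_ k (leqnn k)) [+ _]] := sP k; rewrite take_oversize ?szs.
pose x i := nth 0%N (s i.+1) i.
have xs k : mkseq x k = s k.
  elim: k => [|k ih]; first by apply/esym/size0nil/szs.
  rewrite mkseqS ih /x -sS -[RHS](cat_take_drop k) (drop_nth 0%N) ?szs //.
  by rewrite drop_oversize ?szs // cats1.
have yA k : closureB (A (mkseq x k)) y.
  by have [_ /(_ k (leqnn k)) [_]] := sP k; rewrite take_oversize ?szs // xs.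
have Dx : D x.
  apply: cD => n; have [_ _ [z [Dz zx] _]] := yA n 0%N; exists z => //.
  by move: zx; rewrite size_mkseq => /esym/agree_pre.
exists x => //; apply/funext => i; have [k kP] := cq x i.
(* [y] is a limit of points [q z] with [z] in a cylinder around [x] on which [q] has constant
   coordinate [i]. *)
have [y' yz [z [_ zx] ez]] := yA k i.+1; rewrite (yz i) // -ez; apply: kP.
by move: zx; rewrite size_mkseq => /esym/agree_pre.
Qed.

Lemma uniform_bound (N : nat) (P : nat -> nat -> Prop) :
    (forall i m m', (m <= m')%N -> P i m -> P i m') ->
    (forall i, (i < N)%N -> exists m, P i m) ->
  exists m, forall i, (i < N)%N -> P i m.
Proof.
move=> mono; elim: N => [|N ih] ex; first by exists 0%N.
have [i iN|m mP] := ih; first by apply: ex; apply: ltnW.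
have [m' m'P] := ex N (ltnSn N); exists (maxn m m') => i; rewrite ltnS leq_eqVlt.
case/orP => [/eqP ->|iN]; first by apply: mono m'P; apply: leq_maxr.
by apply: mono (mP i iN); apply: leq_maxl.
Qed.

(** * Continuous maps with countable fibres *)

Section Dichotomy.
Variables (D : set baire) (q : baire -> baire).
Hypotheses (cD : closedB D) (cq : contB q).

Definition partial_inj (C : set baire) :=
  forall x y, D x -> D y -> C x -> C y -> q x = q y -> x = y.

(** Such sets form a sigma-ideal, and the dichotomy asks whether [D] belongs to it. *)
Definition small (B : set baire) := exists C : nat -> set baire,
  [/\ forall n, borelB (C n), forall n, partial_inj (C n) & forall x, B x -> exists n, C n x].

Lemma small_bigcup (B : nat -> set baire) :
  (forall n, small (B n)) -> small [set x | exists n, B n x].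
Proof.
move=> /choice[C CP]; exists (fun j => C (Cantor.of_nat j).1 (Cantor.of_nat j).2); split.
- by move=> n; have [] := CP (Cantor.of_nat n).1.
- by move=> n; have [] := CP (Cantor.of_nat n).1.
- move=> x [n Bx]; have [_ _ /(_ x Bx)[m Cx]] := CP n.
  by exists (Cantor.to_nat (n, m)); rewrite Cantor.cancel_of_to.
Qed.

Lemma small_sub A B : A `<=` B -> small B -> small A.
Proof. by move=> AB [C [bC iC BC]]; exists C; split => // x /AB/BC. Qed.

Lemma small_partial_inj C : borelB C -> partial_inj C -> small C.
Proof. by move=> bC iC; exists (fun _ => C); split => // x Cx; exists 0%N. Qed.

Definition co_small B := borelB B /\ small (D `\` B).

Lemma co_small_bigcap (B : nat -> set baire) :
  (forall n, co_small (B n)) -> co_small [set x | forall n, B n x].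
Proof.
move=> cB; split; first by apply: (sigma_forall borelB_sigma) => n; have [] := cB n.
apply: (@small_sub _ [set x | exists n, (D `\` B n) x]).
  by move=> x [Dx /existsNP[n nB]]; exists n.
by apply: small_bigcup => n; have [] := cB n.
Qed.

(* Two separations: [C1] avoids the points colliding with [A], and [C2] those
   colliding with [C1]. *)
Lemma analytic_partial_inj A : analytic A -> A `<=` D ->
    (forall x y, A x -> A y -> q x = q y -> x = y) ->
  exists C, [/\ borelB C, A `<=` C & partial_inj C].
Proof.
move=> aA AD iA.
pose coll (A : set baire) := [set x | D x /\ exists y, [/\ D y, A y, q x = q y & x <> y]].
have acoll B : analytic B -> analytic (coll B).
  (* [p] records a coordinate where [x] and [y] differ and the value of [x] there; [x <> y] becomes
     a countable union of conditions on each point separately. *)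
  move=> aB; rewrite (_ : coll B = [set x | exists p : nat * nat,
      [set x | D x /\ [set x | [set x | x p.1 = p.2] x /\
        [set x | (q @` [set y | D y /\ [set y | B y /\ [set y | y p.1 <> p.2] y] y]) (q x)] x] x] x]).
    apply: analytic_exists => p; apply: analytic_and; first exact: closedB_analytic.
    apply: analytic_and; first by apply: borelB_analytic; apply: borelB_coord.
    apply: analytic_preimage => //; apply: analytic_image => //.
    apply: analytic_and; first exact: closedB_analytic.
    apply: analytic_and => //; apply: borelB_analytic; apply: (sigma_not borelB_sigma).
    exact: borelB_coord.
  apply/seteqP; split => x /=.
    move=> [Dx [y [Dy By qxy nxy]]].
    have [i nxyi] : exists i, x i <> y i by apply/existsNP => /funext.
    exists (i, x i); split=> //; split=> //; exists y; last by rewrite qxy.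
    by split=> //; split=> // /esym.
  move=> [p [Dx [xp [y [Dy [By yp]] qyx]]]]; split=> //.
  by exists y; split=> // xy; apply: yp; rewrite -xy.
have [|C1 bC1 [AC1 C1A]] := analytic_separation aA (acoll A aA).
  by apply/seteqP; split => x // [Ax [Dx [y [Dy Ay qxy]]]]; apply; apply: iA.
have [|C2 bC2 [AC2 C2A]] := analytic_separation aA (acoll _ (borelB_analytic bC1)).
  apply/seteqP; split => x // [Ax [Dx [y [Dy C1y qxy nxy]]]].
  apply: (C1A y) => //; split=> //; exists x; split=> //.
  exact: nesym.
exists (C1 `&` C2); split; first exact: borelB_and.
  by move=> x Ax; split; [exact: AC1|exact: AC2].
move=> x y Dx Dy [C1x C2x] [C1y C2y] qxy; apply: contrapT => nxy.
by apply: (C2A x) => //; split=> //; exists y; split.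
Qed.

Definition hits (a : seq (seq nat)) (B : set baire) := exists z, forall s, s \in a ->
  exists y, [/\ D y, B y, mkseq y (size s) = s & q y = z].

(** The finite patterns [a] are countably many. For each one that some co-small set fails to
    realise, such a set is chosen; a pattern realised in the intersection of the choices is then
    realised in every co-small set. This is the analogue of passing to a perfect kernel. *)
Lemma co_small_core : exists2 B, co_small B &
  forall a B', hits a B -> co_small B' -> hits a B'.
Proof.
have /choice[B BP] : forall n, exists B, co_small B /\ forall a B', unpickle n = Some a ->
    hits a B -> co_small B' -> hits a B'.
  have coT : co_small setT.
    split; first exact: (sigma_cst borelB_sigma True).
    exists (fun=> set0); split=> [n|n x y _ _ []|x [_ []//]].
    exact: (sigma_cst borelB_sigma False).
  move=> n; case: (unpickle n) => [a|]; last by exists setT.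
  have [[B [cB nB]]|nex] := pselect (exists B, co_small B /\ ~ hits a B).
    by exists B; split=> // a' B' [<-].
  exists setT; split=> // a' B' [<-] _ cB'; apply: contrapT => nh.
  by apply: nex; exists B'.
exists [set x | forall n, B n x]; first by apply: co_small_bigcap => n; have [] := BP n.
move=> a B' [z zP]; have [_ ] := BP (pickle a); apply; first exact: pickleK.
exists z => s /zP[y [Dy By ys qy]]; by exists y.
Qed.

Section Splitting.
Variable B : set baire.
Hypotheses (cB : co_small B) (core : forall a B', hits a B -> co_small B' -> hits a B').

Let o : baire := fun _ => 0%N.

Definition config (ws : seq baire) := exists z, forall w, w \in ws -> [/\ D w, B w & q w = z].

Lemma config_sub ws us : {subset us <= ws} -> config ws -> config us.
Proof. by move=> sub [z zP]; exists z => w /sub/zP. Qed.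

(** The points near [w] whose fibre meets the neighbourhoods of all points of [u] form an analytic
    set [A]. If [q] were injective on [A], a Borel partial injection [C] around [A] could be
    removed; by the core property the prefixes of the configuration would still be realised outside
    [C], which yields a point of [A] outside [C]. Hence [A] has two points in one fibre. *)
Lemma config_split w u n : config (w :: u) ->
  exists x y u', [/\ config [:: x, y & u'], x <> y, agree n w x /\ agree n w y,
    size u' = size u & forall i, (i < size u)%N -> agree n (nth o u i) (nth o u' i)].
Proof.
move=> [z zP].
pose N v := [set x | D x /\ (B x /\ agree n v x)].
pose A := [set x | N w x /\ forall i, (i < size u)%N -> (q @` N (nth o u i)) (q x)].
have aN v : analytic (N v).
  apply: analytic_and; first exact: closedB_analytic.
  apply: analytic_and; first by apply: borelB_analytic; case: cB.
  rewrite (_ : agree n v = cyl setT n v); first by apply: analytic_cyl; apply: closedB_analytic.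
  by apply/seteqP; split => x //= -[].
have aA : analytic A.
  rewrite (_ : A = [set x | N w x /\ [set x | forall i,
      [set x | (i < size u)%N -> (q @` N (nth o u i)) (q x)] x] x]) //.
  apply: analytic_and => //; apply: analytic_bigcap => i; case: (i < size u)%N.
    rewrite (_ : [set x | _] = [set x | (q @` N (nth o u i)) (q x)]).
      apply: (analytic_preimage (A := q @` N (nth o u i)) cq).
      by apply: analytic_image => //; apply: aN.
    by apply/seteqP; split => x //=; apply.
  rewrite (_ : [set x | _] = setT); first by apply: closedB_analytic.
  by apply/seteqP; split.
have [inj|] := pselect (forall x y, A x -> A y -> q x = q y -> x = y).
  have [|C [bC AC iC]] := analytic_partial_inj aA _ inj; first by move=> x [[]].
  have cC : co_small (B `&` ~` C).
    have [bB sB] := cB; split; first by apply: borelB_and => //; apply: (sigma_not borelB_sigma).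
    apply: (@small_sub _ [set x | exists k, (if k is 0 then D `\` B else C) x]).
      move=> x [Dx /not_andP[nB|/contrapT Cx]]; first by exists 0%N.
      by exists 1%N.
    by apply: small_bigcup => -[|k] //; apply: small_partial_inj.
  have [] := core (a := [seq mkseq v n | v <- w :: u]) _ cC.
    exists z => _ /mapP[v vu ->]; have [Dv Bv qv] := zP v vu.
    by exists v; rewrite size_mkseq.
  move=> z' z'P; exfalso.
  have wit v : v \in w :: u -> exists y, [/\ N v y, ~ C y & q y = z'].
    move=> vu; have [|y [Dy [By Cy] yv qy]] := z'P (mkseq v n); first by apply/mapP; exists v.
    exists y; split=> //; split=> //; split=> //.
    by move: yv; rewrite size_mkseq => /esym/agree_pre.
  have [x [Nx nCx qx]] := wit w (mem_head _ _); apply/nCx/AC; split=> // i iu.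
  have [|y [Ny _ qy]] := wit (nth o u i); first by rewrite inE mem_nth ?orbT.
  by exists y => //; rewrite qx.
move=> /existsNP[x /existsNP[y /not_implyP[Ax /not_implyP[Ay /not_implyP[qxy nxy]]]]].
have [[Dx [Bx wx]] xu] := Ax; have [[Dy [By wy]] _] := Ay.
have /choice[f fP] : forall i, exists v, (i < size u)%N -> N (nth o u i) v /\ q v = q x.
  move=> i; case: (boolP (i < size u)%N) => [/xu[v Nv qv]|_]; first by exists v.
  by exists o.
exists x, y, (mkseq f (size u)); rewrite size_mkseq; split=> //.
  exists (q x) => v; rewrite !inE => /or3P[/eqP ->|/eqP ->|/mapP[i]] //.
  by rewrite mem_iota => /fP[[Dv [Bv _]] qv] ->.
by move=> i iu; rewrite nth_mkseq //; have [[_ []]] := fP i iu.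
Qed.

(** Points of [a] are split one at a time; [b] holds those that are only carried along, and the two
    halves of a split point are appended to it. *)
Lemma config_split_all k : forall a b n, size a = k -> config (a ++ b) -> exists a' b',
  [/\ config (a' ++ b'), size a' = k.*2, size b' = size b,
    forall i, (i < k)%N -> [/\ agree n (nth o a i) (nth o a' i.*2),
      agree n (nth o a i) (nth o a' i.*2.+1) & nth o a' i.*2 <> nth o a' i.*2.+1] &
    forall i, (i < size b)%N -> agree n (nth o b i) (nth o b' i)].
Proof.
elim: k => [|k ih] a b n; first by move=> /size0nil -> cb; exists [::], b.
case: a => // w a [sa] cab.
have [x [y [u [cxyu nxy [wx wy]]]]] := config_split n cab.
rewrite size_cat sa => su ua; have [m nm] := agree_neq nxy.
have st : size (take k u) = k by rewrite size_take_min; apply/minn_idPl; rewrite su leq_addr.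
have sd : size (drop k u) = size b by rewrite size_drop su addKn.
(* Later splits perturb [x] and [y]; a precision of at least [m], where these differ, keeps the
   perturbed copies distinct. *)
have [|a' [b' [cab' sa' + aP bP]]] :=
    ih (take k u) (drop k u ++ [:: x; y]) (maxn n m) st.
  apply: config_sub cxyu => v.
  rewrite catA cat_take_drop mem_cat !inE => /or3P[vu|/eqP ->|/eqP ->].
  - by rewrite vu !orbT.
  - by rewrite eqxx.
  - by rewrite eqxx orbT.
rewrite size_cat sd /= => sb'.
have bx i : (i < size b)%N -> agree n (nth o b i) (nth o b' i).
  move=> ib; have -> : nth o b i = nth o (a ++ b) (k + i).
    by rewrite nth_cat sa ltnNge leq_addr addKn.
  apply: agree_trans (ua _ _) _; first by rewrite ltn_add2l.
  apply: (@agree_le _ _ (maxn n m)); first exact: leq_maxl.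
  have := bP i; rewrite size_cat sd nth_cat sd ib nth_drop; apply.
  by rewrite ltn_addr.
have bX : agree (maxn n m) x (nth o b' (size b)).
  have := bP (size b); rewrite size_cat sd nth_cat sd ltnn subnn /=; apply.
  by rewrite addn2 ltnS leqnSn.
have bY : agree (maxn n m) y (nth o b' (size b).+1).
  have := bP (size b).+1; rewrite size_cat sd nth_cat sd subSnn /=.
  by rewrite (_ : ((size b).+1 < size b)%N = false) //=; [apply; rewrite addn2|lia].
exists [:: nth o b' (size b), nth o b' (size b).+1 & a'], (take (size b) b'); split.
- apply: config_sub cab' => v; rewrite /= !inE !mem_cat => /or4P[/eqP ->|/eqP ->|->//|/mem_take ->].
  + by rewrite mem_nth ?orbT // sb' addn2 ltnS leqnSn.
  + by rewrite mem_nth ?orbT // sb' addn2.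
  + by rewrite orbT.
- by rewrite /= sa' doubleS.
- by rewrite size_take_min; apply/minn_idPl; rewrite sb' leq_addr.
- case=> [_|i ik]; rewrite ?doubleS /=.
    split.
    + by apply: agree_trans wx (agree_le _ bX); apply: leq_maxl.
    + by apply: agree_trans wy (agree_le _ bY); apply: leq_maxl.
    + move=> e; apply: nm; apply: (@agree_le _ _ (maxn n m)); first exact: leq_maxr.
      by apply: agree_trans bX _; rewrite e; apply: agree_sym.
  have [a1 a2 a3] := aP i ik.
  have ai : agree n (nth o a i) (nth o (take k u) i).
    rewrite nth_take //; have := ua i; rewrite nth_cat sa (ik : (i < k)%N); apply.
    by rewrite ltn_addr.
  split=> //.
  + by apply: agree_trans ai (agree_le _ a1); apply: leq_maxl.
  + by apply: agree_trans ai (agree_le _ a2); apply: leq_maxl.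
- by move=> i ib; rewrite nth_take //; apply: bx.
Qed.

(** A binary tree of configurations in which node [i] has children [2i] and [2i+1]. The common fibre
    may change from one level to the next; only the points converge along branches. *)
Lemma cantor_scheme w : D w -> B w -> exists (m : nat -> nat) (a : nat -> seq baire),
  [/\ forall k, size (a k) = (2 ^ k)%N, forall k, config (a k), forall k, (m k < m k.+1)%N,
    forall k i, (i < 2 ^ k)%N -> forall b : bool,
      agree (m k) (nth o (a k) i) (nth o (a k.+1) (b + i.*2)%N) &
    forall k i, (i < 2 ^ k)%N ->
      ~ agree (m k.+1) (nth o (a k.+1) i.*2) (nth o (a k.+1) i.*2.+1)].
Proof.
move=> Dw Bw.
have /choice[f fP] : forall p : nat * seq baire, exists p' : nat * seq baire, config p.2 ->
    [/\ config p'.2, size p'.2 = (size p.2).*2, (p.1 < p'.1)%N,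
      forall i, (i < size p.2)%N -> forall b : bool,
        agree p.1 (nth o p.2 i) (nth o p'.2 (b + i.*2)%N) &
      forall i, (i < size p.2)%N -> ~ agree p'.1 (nth o p'.2 i.*2) (nth o p'.2 i.*2.+1)].
  move=> [n a] /=; have [ca|nc] := pselect (config a); last by exists (n, a).
  have [|a' [b' [ca' sa' _ aP _]]] := @config_split_all (size a) a [::] n erefl.
    by rewrite cats0.
  (* One precision separates all pairs of siblings of the new level. *)
  have [|i|m mP] := @uniform_bound (size a)
      (fun i m => ~ agree m (nth o a' i.*2) (nth o a' i.*2.+1)).
  - by move=> i m m' mm'; apply: contra_not; apply: agree_le.
  - by move=> /aP[_ _ /agree_neq].
  exists (maxn n.+1 m, a') => _ /=; split=> //.
  - by apply: config_sub ca' => v va; rewrite mem_cat va.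
  - by rewrite leq_max leqnn.
  - by move=> i /aP[a1 a2 _] [].
  - move=> i /mP; apply: contra_not; apply: agree_le; exact: leq_maxr.
pose p := fix p k := if k is k'.+1 then f (p k') else (0%N, [:: w]).
have cp k : config (p k).2.
  elim: k => [|k ih] /=; last by have [] := fP (p k) ih.
  by exists (q w) => v; rewrite inE => /eqP ->.
have sp k : size (p k).2 = (2 ^ k)%N.
  elim: k => //= k ih; have [_ -> _ _ _] := fP (p k) (cp k).
  by rewrite ih expnS mul2n.
exists (fun k => (p k).1), (fun k => (p k).2); split=> // k.
- by have [] := fP (p k) (cp k).
- by move=> i; rewrite -sp => ik b; have [_ _ _ + _] := fP (p k) (cp k); apply.
- by move=> i; rewrite -sp => ik; have [_ _ _ _] := fP (p k) (cp k); apply.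
Qed.

End Splitting.

Fixpoint binary_index (b : nat -> bool) k : nat :=
  if k is k'.+1 then (b k' + (binary_index b k').*2)%N else 0%N.

Lemma binary_index_lt b k : (binary_index b k < 2 ^ k)%N.
Proof. by elim: k => //= k ih; rewrite expnS; case: (b k) => /=; lia. Qed.

Lemma binary_index_agree b c k : agree k b c -> binary_index b k = binary_index c k.
Proof.
elim: k => //= k ih bc; rewrite ih ?bc //.
by apply: agree_le bc.
Qed.

(* For constant [q] this is the perfect set theorem, for countable-to-one [q] it
   is the theorem of Lusin and Novikov. *)
Theorem fibre_dichotomy : small D \/ exists psi : (nat -> bool) -> baire,
  [/\ contB psi, injective psi, forall b, D (psi b) & forall b c, q (psi b) = q (psi c)].
Proof.
have [?|nsD] := pselect (small D); [by left|right].
have [B cB core] := co_small_core.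
have [w [Dw Bw]] : exists w, D w /\ B w.
  apply: contrapT => nex; apply: nsD; have [_] := cB; apply: small_sub => x Dx; split=> // Bx.
  by apply: nex; exists x.
have [m [a [sa ca mm aS aN]]] := cantor_scheme cB core Dw Bw.
pose y b k := nth (fun _ => 0%N) (a k) (binary_index b k).
have yi b k : y b k \in a k by apply: mem_nth; rewrite sa binary_index_lt.
have mk k : (k <= m k)%N by elim: k => // k ih; apply: leq_ltn_trans ih (mm k).
pose psi b := (fun i => y b i.+1 i) : baire.
have psiP b k : agree (m k) (psi b) (y b k).
  apply: agree_limit => // [k'|k']; first exact: ltnW.
  by apply: aS; apply: binary_index_lt.
have Dpsi b : D (psi b).
  apply: cD => n; exists (y b n); first by apply: agree_le (psiP b n).
  by have [z /(_ _ (yi b n)) []] := ca n.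
exists psi; split=> //.
(* [psi b i] is read off at level [i+1], which depends only on the first [i+1] bits. *)
- move=> b i; exists i.+1 => c bc; rewrite /psi /y.
  by rewrite (binary_index_agree bc).
- move=> b c bc; apply/funext => i.
  have [k kP] : exists k, (i < k)%N by exists i.+1.
  elim: k i kP => // k ih i; rewrite ltnS leq_eqVlt => /orP[/eqP ->|]; last exact: ih.
  (* The branches agree below [k], so different bits at [k] would lead to siblings, which are
     separated. *)
  have e : binary_index b k = binary_index c k by apply: binary_index_agree => j; apply: ih.
  have := aN k _ (binary_index_lt b k).
  have := psiP b k.+1; have := psiP c k.+1; rewrite /y /= -e bc.
  case: (b k); case: (c k) => // /= p1 p2 []; rewrite ?add0n ?add1n in p1 p2.
    by apply: agree_trans p2; apply: agree_sym.
  by apply: agree_trans p1; apply: agree_sym.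
(* At each level both branches pass through one configuration, where [q] takes a single value;
   continuity transfers the equality to the limits. *)
- move=> b c; apply/funext => i.
  have [k kP] := cq (psi b) i; have [l lP] := cq (psi c) i.
  pose n := maxn k l.
  rewrite (kP (y b n)); last first.
    by apply: agree_le (psiP b n); apply: leq_trans (mk n); apply: leq_maxl.
  rewrite (lP (y c n)); last first.
    by apply: agree_le (psiP c n); apply: leq_trans (mk n); apply: leq_maxr.
  have [z zP] := ca n; have [_ _ ->] := zP _ (yi b n).
  by have [_ _ ->] := zP _ (yi c n).
Qed.

End Dichotomy.

(** * Standard Borel spaces as Borel subsets of Baire space *)

(** An isomorphism of Borel structures with a Borel subset of Baire space. *)
Definition encodes (X : Type) (S : set (set X)) (c : X -> baire) :=
  [/\ injective c, borelB (range c) &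
      forall A, S A <-> exists2 B, borelB B & A = c @^-1` B].

Section PolishCode.
Import Order.TTheory GRing.Theory Num.Theory.
Local Open Scope ring_scope.
Variables (R : realType) (M : metricType R) (d : nat -> M).
Hypothesis d_dense : forall x e, 0 < e -> exists i, mdist x (d i) < e.
Hypothesis M_complete :
  forall F : set_system M, ProperFilter F -> cauchy F -> exists l : M, F --> l.

Let r (k : nat) : R := k.+1%:R^-1.

Let r_gt0 k : 0 < r k. Proof. by rewrite invr_gt0 ltr0n. Qed.

Let r_small e : 0 < e -> exists k, r k < e.
Proof. by move=> /ltr_add_invr[k]; rewrite add0r; exists k. Qed.

Let r_small2 e : 0 < e -> exists k, r k + r k < e.
Proof.
move=> e0; have [k ke] := r_small (divr_gt0 e0 (ltr0n _ 2)).
by exists k; rewrite (splitr e) ltrD.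
Qed.

Let r_le k l : (k <= l)%N -> r l <= r k.
Proof. by move=> kl; rewrite lef_pV2 ?posrE ?ltr0n // ler_nat ltnS. Qed.

Definition metric_code (x : M) : baire := fun j =>
  nat_of_bool (mdist x (d (Cantor.of_nat j).1) < r (Cantor.of_nat j).2).

Let bit (i k : nat) (z : baire) := z (Cantor.to_nat (i, k)) = 1%N.

Lemma bit_code i k x : bit i k (metric_code x) <-> mdist x (d i) < r k.
Proof. by rewrite /bit /metric_code Cantor.cancel_of_to /=; case: (_ < _). Qed.

Lemma metric_code_inj : injective metric_code.
Proof.
move=> x y exy; apply: contrapT => /eqP nxy.
have [k kP] : exists k, r k + r k < mdist x y by apply: r_small2; rewrite mdist_gt0.
have [i xi] := d_dense x (r_gt0 k).
have yi : mdist y (d i) < r k by rewrite -bit_code -exy bit_code.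
have := metric_triangle x (d i) y; rewrite (metric_sym (d i) y) leNgt => /negP; apply.
by apply: lt_trans kP; apply: ltrD.
Qed.

(** Countably many conditions that characterise the codes, so that their range is Borel: bits are 0
    or 1, balls of every radius occur, any two balls named have centres closer than the sum of their
    radii, and a ball is named exactly when its centre and radius leave strict room for a named ball
    inside. *)
Let coherent (z : baire) :=
  (forall j, z j = 0%N \/ z j = 1%N) /\
  ((forall k, exists i, bit i k z) /\
  ((forall p : nat * nat * (nat * nat), bit p.1.1 p.1.2 z -> bit p.2.1 p.2.2 z ->
    mdist (d p.1.1) (d p.2.1) < r p.1.2 + r p.2.2) /\
  (forall p : nat * nat, bit p.1 p.2 z <->
    exists p' : nat * nat, bit p'.1 p'.2 z /\ mdist (d p.1) (d p'.1) + r p'.2 < r p.2))).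

Let borelB_coherent : borelB [set z | coherent z].
Proof.
have bbit i k : borelB [set z | bit i k z] by apply: borelB_coord.
apply: (sigma_and borelB_sigma).
  apply: (sigma_forall borelB_sigma) => j.
  by apply: (sigma_or borelB_sigma); apply: borelB_coord.
apply: (sigma_and borelB_sigma).
  by apply: (sigma_forall borelB_sigma) => k; apply: (sigma_exists borelB_sigma) => i.
apply: (sigma_and borelB_sigma).
  apply: (sigma_forall borelB_sigma) => p; apply: (sigma_imply borelB_sigma) => //.
  by apply: (sigma_imply borelB_sigma) => //; apply: sigma_cst.
apply: (sigma_forall borelB_sigma) => p; apply: (sigma_iff borelB_sigma) => //.
apply: (sigma_exists borelB_sigma) => p'; apply: (sigma_and borelB_sigma) => //.
exact: sigma_cst.
Qed.

Let coherent_code x : coherent (metric_code x).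
Proof.
split; first by move=> j; rewrite /metric_code; case: (_ < _); [right|left].
split; first by move=> k; have [i xi] := d_dense x (r_gt0 k); exists i; rewrite bit_code.
split.
  move=> [[i k] [j l]] /=; rewrite !bit_code => xi xj.
  by apply: le_lt_trans (metric_triangle _ x _) _; rewrite (metric_sym (d i)) ltrD.
move=> [i k] /=; rewrite bit_code; split.
  move=> xi; have [l lP] := r_small2 (etrans (subr_gt0 _ _) xi).
  have [j xj] := d_dense x (r_gt0 l); exists (j, l); rewrite /= bit_code; split=> //.
  move: lP; rewrite ltrBrDl addrA; apply: le_lt_trans; rewrite lerD2r.
  by apply: le_trans (metric_triangle _ x _) _; rewrite (metric_sym (d i)) lerD2l ltW.
move=> [[j l] /=]; rewrite bit_code => -[xj]; apply: le_lt_trans.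
apply: le_trans (metric_triangle _ (d j) _) _; rewrite addrC (metric_sym (d j)).
by rewrite lerD2l ltW.
Qed.

Let coherent_range z : coherent z -> exists x, metric_code x = z.
Proof.
move=> [z01 [/choice[u uP] [zb zc]]].
have uu n m : mdist (d (u n)) (d (u m)) < r n + r m.
  exact: (zb ((u n, n), (u m, m)) (uP n) (uP m)).
(* Centres chosen for shrinking radii form a Cauchy sequence; completeness supplies the point coded
   by [z]. *)
have [x xP] : exists x : M, (d \o u) @ \oo --> x.
  apply: M_complete; apply: cauchy_exP => e e0.
  have [k kP] := r_small2 e0; exists (d (u k)).
  exists k => // n /= kn; rewrite ballEmdist /=.
  by apply: lt_trans kP; apply: lt_le_trans (uu k n) _; rewrite lerD2l r_le.
have xu n : mdist x (d (u n)) <= r n.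
  apply/ler_addgt0Pl => e e0; have e2 : 0 < e / 2 by rewrite divr_gt0.
  have [k kP] := r_small e2.
  have [N _ NP] := (cvg_ballP _ _).1 xP _ e2.
  pose m := maxn N k; have := NP m (leq_maxl _ _); rewrite ballEmdist /= => xm.
  apply: le_trans (metric_triangle _ (d (u m)) _) _.
  rewrite (splitr e) -addrA; apply: lerD; first exact: ltW.
  apply: le_trans (ltW (uu m n)) _; rewrite lerD2r.
  by apply: le_trans (ltW kP); apply: r_le; apply: leq_maxr.
have dP i k : bit i k z <-> mdist x (d i) < r k.
  rewrite (zc (i, k)) /=; split.
    move=> [[j l] /= [zj]]; apply: le_lt_trans.
    apply: le_trans (metric_triangle _ (d j) _) _; rewrite addrC (metric_sym (d j)) lerD2l.
    apply/ler_addgt0Pl => e e0; have [n nP] := r_small2 e0.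
    apply: le_trans (metric_triangle _ (d (u n)) _) _.
    have := zb ((u n, n), (j, l)) (uP n) zj => /= /ltW ujl.
    apply: le_trans (lerD (xu n) ujl) _.
    by rewrite addrA lerD2r ltW.
  move=> xi; have [l lP] := r_small2 (etrans (subr_gt0 _ _) xi).
  exists (u l, l) => /=; split; first exact: uP.
  move: lP; rewrite ltrBrDl addrA; apply: le_lt_trans; rewrite lerD2r.
  apply: le_trans (metric_triangle _ x _) _; rewrite (metric_sym (d i)) lerD2l.
  exact: xu.
exists x; apply/funext => j; rewrite -(Cantor.cancel_to_of j).
case: (Cantor.of_nat j) => i k; rewrite /metric_code Cantor.cancel_of_to /=.
have [zj|zj] := z01 (Cantor.to_nat (i, k)); rewrite zj.
  by case: (boolP (_ < _)) => // /dP; rewrite /bit zj.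
by have /dP -> : bit i k z.
Qed.

Let metric_codeP (A : set M) : <<s @open M >> A <-> exists2 B, borelB B & A = metric_code @^-1` B.
Proof.
have sM := smallest_sigma (@open M).
have bM i k : <<s @open M >> [set x | mdist x (d i) < r k].
  apply: sub_gen_smallest; rewrite openE /= => x /= xi.
  apply/nbhs_ballP; exists (r k - mdist x (d i)); first by rewrite /= subr_gt0.
  move=> y; rewrite ballEmdist /= ltrBrDr (metric_sym x y).
  by apply: le_lt_trans; apply: metric_triangle.
split; last first.
  move=> [B bB ->]; apply: sigma_borelB bB => // i j.
  rewrite /metric_code; case: j => [|[|j]].
  - rewrite (_ : [set x | _] = [set x | ~ mdist x (d (Cantor.of_nat i).1) < r (Cantor.of_nat i).2]).
      exact: (sigma_not sM (bM _ _)).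
    by apply/seteqP; split => x /=; case: (_ < _).
  - rewrite (_ : [set x | _] = [set x | mdist x (d (Cantor.of_nat i).1) < r (Cantor.of_nat i).2]) //.
    by apply/seteqP; split => x /=; case: (_ < _).
  - rewrite (_ : [set x | _] = [set _ | False]); first exact: sigma_cst.
    by apply/seteqP; split => x /=; case: (_ < _).
apply: (@smallest_sigma_ind _ _ [set A | exists2 B, borelB B & A = metric_code @^-1` B]).
  split=> /=.
  - by exists set0; [exact: (sigma_cst borelB_sigma False)|rewrite preimage_set0].
  - move=> _ [B bB ->]; exists (~` B); first exact: (sigma_not borelB_sigma).
    by rewrite setTD preimage_setC.
  - move=> F FP; have /choice[B BP] : forall n, exists B, borelB B /\ F n = metric_code @^-1` B.
      by move=> n; have [B] := FP n; exists B.
    exists [set x | exists n, B n x]; first by apply: borelB_bigcup => n; have [] := BP n.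
    apply/seteqP; split => x /= => [[n _]|[n Bx]].
      by have [_ ->] := BP n; exists n.
    by exists n => //; have [_ ->] := BP n.
move=> U oU /=.
(* An open set is the union of the basic balls inside it, and these are countably many. *)
exists [set z | exists p : nat * nat, [set x | mdist x (d p.1) < r p.2] `<=` U /\ bit p.1 p.2 z].
  apply: (sigma_exists borelB_sigma) => p; apply: (sigma_and borelB_sigma).
    exact: sigma_cst.
  exact: borelB_coord.
apply/seteqP; split => x /=; last by move=> [p [pU /bit_code/pU]].
move=> Ux; have : nbhs x U by move: oU Ux; rewrite openE; apply.
move=> /nbhs_ballP[e /= e0 eU]; have [k kP] := r_small2 e0.
have [i xi] := d_dense x (r_gt0 k); exists (i, k); rewrite /= bit_code; split=> // y /= yi.
apply: eU; rewrite ballEmdist /=; apply: le_lt_trans (metric_triangle _ (d i) _) _.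
by apply: lt_trans kP; rewrite (metric_sym (d i)) ltrD.
Qed.

Lemma encodes_metric_code : encodes <<s @open M >> metric_code.
Proof.
split; [exact: metric_code_inj| |exact: metric_codeP].
rewrite (_ : range _ = [set z | coherent z]) //.
apply/seteqP; split => z /=; first by move=> [x _ <-]; apply: coherent_code.
by move=> /coherent_range[x <-]; exists x.
Qed.

End PolishCode.

Lemma polish_encodes (R : realType) (M : metricType R) :
  polish M -> exists c, encodes <<s @open M >> c.
Proof.
move=> [[D cD dD] complete].
have [[x0 _]|nM] := pselect (exists x : M, True); last first.
  exists (fun _ _ => 0%N); split.
  - by move=> x; exfalso; apply: nM; exists x.
  - rewrite (_ : range _ = set0); first exact: (sigma_cst borelB_sigma False).
    by apply/seteqP; split => // z [x _ _]; exfalso; apply: nM; exists x.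
  - have em (A B : set M) : A = B.
      by apply/seteqP; split => x; exfalso; apply: nM; exists x.
    move=> A; split=> _; last by rewrite (em A set0); case: (smallest_sigma (@open M)).
    by exists set0; [exact: (sigma_cst borelB_sigma False)|exact: em].
have dense_ball x e : (0 < e)%R -> exists2 y, D y & (mdist x y < e)%R.
  move=> e0; have [||y [/interior_subset + Dy]] := dD (ball x e)^°.
  - by exists x; apply: nbhsx_ballx.
  - exact: open_interior.
  - by rewrite ballEmdist; exists y.
have [y0 Dy0 _] := dense_ball x0 1%R Num.Theory.ltr01.
have /countable_injP[f fi] := cD.
have /choice[d dP] : forall n, exists y, forall x, D x -> f x = n -> y = x.
  move=> n; have [[x [Dx fx]]|nex] := pselect (exists x, D x /\ f x = n).
    by exists x => y Dy fy; apply: fi; rewrite ?inE // fx fy.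
  by exists y0 => x Dx fx; exfalso; apply: nex; exists x.
exists (metric_code d); apply: encodes_metric_code => // x e e0.
by have [y Dy xy] := dense_ball x e e0; exists (f y); rewrite (dP _ y).
Qed.

Lemma standard_borel_encodes (R : realType) (X : standardBorelType R) :
  exists c, encodes (borel X) c.
Proof.
have [M [h [pM [g hK gK] bX]]] := borel_polish X.
have [c [ci rc cP]] := polish_encodes pM.
exists (fun x => c (h x)); split.
- by move=> x y /ci /(can_inj hK).
- suff -> : range (fun x => c (h x)) = range c by []; apply/seteqP; split => _ [x _ <-].
    by exists (h x).
  by exists (g x); rewrite ?gK.
- have hE A : h @` A = g @^-1` A.
    apply/seteqP; split => x /=; first by move=> [y Ay <-]; rewrite hK.
    by move=> Agx; exists (g x).
  move=> A; rewrite bX cP; split=> -[B bB AB]; exists B => //.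
    apply/seteqP; split => x /= Ax.
      by have : (h @` A) (h x) by [exists x]; rewrite AB.
    by have : (h @` A) (h x) by [rewrite AB]; rewrite hE /= hK.
  by rewrite AB; apply/seteqP; split => x /= => [[y By <-]//|Bx]; exists (g x); rewrite ?gK.
Qed.

Lemma borel_sigma (R : realType) (X : standardBorelType R) :
  sigma_algebra [set: X] (borel X).
Proof.
have [c [ci rc cP]] := standard_borel_encodes X; split.
- by apply/cP; exists set0; [exact: (sigma_cst borelB_sigma False)|rewrite preimage_set0].
- move=> A /cP[B bB ->]; apply/cP; exists (~` B); first exact: (sigma_not borelB_sigma).
  by rewrite setTD preimage_setC.
- move=> F FP; have /choice[B BP] : forall n, exists B, borelB B /\ F n = c @^-1` B.
    by move=> n; have /cP[B] := FP n; exists B.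
  apply/cP; exists [set x | exists n, B n x].
    by apply: borelB_bigcup => n; have [] := BP n.
  apply/seteqP; split => x /= => [[n _]|[n Bx]].
    by have [_ ->] := BP n; exists n.
  by exists n => //; have [_ ->] := BP n.
Qed.

Lemma cantor_uncountable (g : (nat -> bool) -> nat) : ~ injective g.
Proof.
move=> gi; pose b n := `[< exists c, g c = n /\ c n = false >].
have := asboolP (exists c, g c = g b /\ c (g b) = false); rewrite -/(b (g b)).
case E : (b (g b)) => /Bool.reflect_iff [h1 h2].
  by have [c [/gi -> ]] := h2 erefl; rewrite E.
by have : false by apply: h1; exists b.
Qed.

Lemma borelB_inj_cont_image (B : set baire) (p : baire -> baire) :
  borelB B -> contB p -> {in B &, injective p} -> borelB (p @` B).
Proof.
move=> /borelB_inj_image[D [phi [[cD cphi ->] /set_injP iphi]]] cp /set_injP ip.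
rewrite image_comp; apply: lusin_souslin => //; first exact: contB_comp cphi cp.
by apply/set_injP => x y Dx Dy e; apply: iphi => //; apply: ip.
Qed.

(** * Injective images, Lusin-Novikov and perfect sets in standard Borel spaces *)

Section StandardBorel.
Variables (R : realType) (X : standardBorelType R).

Definition borel_map (f : X -> baire) := forall B, borelB B -> borel X (f @^-1` B).

(** Trades a Borel map on [X] for a continuous one on a closed set, to which the dichotomy applies:
    a point of [D] codes a point of the graph, with [p] its argument and [q] its value. *)
Lemma graph_presentation (A : set X) (f : X -> baire) (c : X -> baire) :
    encodes (borel X) c -> borel X A -> borel_map f ->
  exists (D : set baire) (p q : baire -> baire),
  [/\ closedB D, contB p /\ contB q, {in D &, injective p},
      forall w, D w -> exists x, [/\ A x, p w = c x & q w = f x] &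
      forall x, A x -> exists w, [/\ D w, p w = c x & q w = f x]].
Proof.
move=> [ci rc cP] bA bf.
have cimage B : borel X B -> borelB (c @` B).
  move=> /cP[B' bB' ->]; rewrite (_ : _ @` _ = B' `&` range c); first exact: borelB_and.
  apply/seteqP; split => y /= => [[x Bx <-]|[By [x _ exy]]]; first by split=> //; exists x.
  by exists x => //=; rewrite exy.
(* Column 0 is the argument and every other column repeats the value; no column is left free, which
   makes [p] injective. *)
pose G := [set z : baire | (c @` A) (col 0 z) /\ forall t : nat * nat * nat,
  z (Cantor.to_nat (t.1.1.+1, t.1.2)) = t.2 <-> (c @` [set x | f x t.1.2 = t.2]) (col 0 z)].
have bG : borelB G.
  apply: (sigma_and borelB_sigma); first by apply: contB_borelB; [exact: contB_col|exact: cimage].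
  apply: (sigma_forall borelB_sigma) => t; apply: (sigma_iff borelB_sigma).
    exact: borelB_coord.
  apply: contB_borelB; first exact: contB_col.
  by apply: cimage; apply: (bf [set z | z t.1.2 = t.2]); apply: borelB_coord.
have Gcol z x n : G z -> col 0 z = c x -> col n.+1 z = f x.
  move=> [_ Gz] zx; apply/funext => i; apply/(Gz (n, i, f x i)) => /=.
  by rewrite zx; exists x.
have [D [phi [[cD cphi GE] /set_injP iphi]]] := borelB_inj_image bG.
have GD w : D w -> G (phi w) by move=> Dw; rewrite GE; exists w.
exists D, (fun w => col 0 (phi w)), (fun w => col 1 (phi w)); split=> //.
- by split; apply: (contB_comp cphi); apply: contB_col.
- apply/set_injP => w w' Dw Dw' e; apply: iphi => //; apply: col_inj => -[//|n].
  have [[x Ax cx] _] := GD w Dw.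
  by rewrite (Gcol _ x n (GD _ Dw)) ?(Gcol _ x n (GD _ Dw')) // -?e.
- move=> w Dw; have [[x Ax cx] _] := GD w Dw; exists x; split=> //.
  by apply: Gcol => //; apply: GD.
- move=> x Ax; pose z := cols (fun n => if n is 0 then c x else f x).
  have zE n i : z (Cantor.to_nat (n.+1, i)) = f x i by rewrite /z /cols Cantor.cancel_of_to.
  have Gz : G z.
    split; first by rewrite colK; exists x.
    move=> [[n i] j]; rewrite colK; split=> [e|[y fy /ci yx]].
      by exists x => //; exact: etrans (esym (zE n i)) e.
    by apply: etrans (zE n i) _; rewrite -yx.
  have [w Dw ew] : (phi @` D) z by rewrite -GE.
  by exists w; rewrite ew !colK.
Qed.

Lemma borelB_inj_image_of (A : set X) (f : X -> baire) :
    borel X A -> borel_map f -> (forall x y, A x -> A y -> f x = f y -> x = y) ->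
  borelB (f @` A).
Proof.
move=> bA bf fi; have [c cX] := standard_borel_encodes X.
have [D [p [q [cD [cp cq] /set_injP ip DA AD]]]] := graph_presentation cX bA bf.
rewrite (_ : f @` A = q @` D).
  apply: lusin_souslin => //; apply/set_injP => w w' Dw Dw' e; apply: ip => //.
  have [x [Ax -> qx]] := DA w Dw; have [y [Ay -> qy]] := DA w' Dw'.
  by rewrite (fi x y) // -qx -qy.
apply/seteqP; split => z [x].
  by move=> /AD[w [Dw _ <-]] <-; exists w.
by move=> /DA[y [Ay _ ->]] <-; exists y.
Qed.

Theorem lusin_novikov (f : X -> baire) : borel_map f ->
    (forall x, countable [set y | f x = f y]) ->
  exists A : nat -> set X, [/\ forall n, borel X (A n),
    forall n x y, A n x -> A n y -> f x = f y -> x = y & forall x, exists n, A n x].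
Proof.
move=> bf cf; have [c cX] := standard_borel_encodes X; have [ci _ cP] := cX.
have [D [p [q [cD [cp cq] ip DA AD]]]] :=
  graph_presentation cX (sigma_cst (borel_sigma X) True) bf.
have bD : borelB D.
  rewrite (_ : D = closureB D); first exact: borelB_closureB.
  by apply/seteqP; split => x; [move=> Dx n; exists x|apply: cD].
have [[C [bC iC DC]]|[psi [_ psii Dpsi qpsi]]] := fibre_dichotomy cD cq.
  exists (fun n => c @^-1` (p @` (D `&` C n))); split.
  - move=> n; apply/cP; eexists; last reflexivity.
    apply: borelB_inj_cont_image => //; first exact: borelB_and.
    apply/set_injP => w w' [Dw _] [Dw' _]; move/set_injP: ip; exact.
  - move=> n x y [w [Dw Cw] wx] [w' [Dw' Cw'] wy] fxy; apply: (ci); rewrite -wx -wy.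
    congr p; apply: (iC n w w') => //.
    have [x' [_ e1 ->]] := DA w Dw; have [y' [_ e2 ->]] := DA w' Dw'.
    have <- : x = x' by apply: (ci); rewrite -wx.
    by have <- : y = y' by apply: (ci); rewrite -wy.
  - by move=> x; have [w [Dw pw _]] := AD x I; have [n Cw] := DC w Dw; exists n; exists w.
(* A Cantor set inside one fibre of [q] would inject [nat -> bool] into a countable fibre of [f]. *)
exfalso; have /choice[g gP] : forall b, exists x, p (psi b) = c x /\ q (psi b) = f x.
  by move=> b; have [x [_ e1 e2]] := DA _ (Dpsi b); exists x.
pose b0 : nat -> bool := fun _ => true.
have /countable_injP[h hi] := cf (g b0).
apply: (@cantor_uncountable (h \o g)) => b b' /= e.
have fg x : [set y | f (g b0) = f y] (g x).
  by rewrite /= -(gP b0).2 -(gP x).2.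
have {}e : g b = g b' by apply: hi; rewrite ?inE.
apply: psii; move/set_injP: ip; apply => //.
by rewrite (gP b).1 (gP b').1 e.
Qed.

Theorem perfect_set (A : set X) : borel X A -> ~ countable A ->
  exists psi : baire -> X, [/\ injective psi, forall z, A (psi z) &
    forall B, borel X B -> borelB (psi @^-1` B)].
Proof.
move=> bA uA; have [c cX] := standard_borel_encodes X; have [ci _ cP] := cX.
(* For a constant map all of [A] is a single fibre. *)
pose o : baire := fun _ => 0%N.
have bo : borel_map (fun _ => o).
  by move=> B _; apply: (sigma_cst (borel_sigma X) (B o)).
have [D [p [q [cD [cp cq] ip DA AD]]]] := graph_presentation cX bA bo.
have [[C [bC iC DC]]|[psi [cpsi psii Dpsi qpsi]]] := fibre_dichotomy cD cq.
  exfalso; apply: uA; have /choice[g gP] : forall x, exists n, A x -> exists w,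
      [/\ D w, C n w & p w = c x].
    move=> x; have [/AD[w [Dw pw _]]|nA] := pselect (A x); last by exists 0%N.
    by have [n Cn] := DC w Dw; exists n => _; exists w.
  apply/countable_injP; exists g; apply/set_injP => x y Ax Ay gxy.
  have [w [Dw Cw pw]] := gP x Ax; have [w' [Dw' Cw' pw']] := gP y Ay.
  apply: ci; rewrite -pw -pw'; congr p; apply: (iC (g x)) => //; first by rewrite gxy.
  by have [x' [_ _ ->]] := DA w Dw; have [y' [_ _ ->]] := DA w' Dw'.
(* The characteristic function of the graph of [z]: a continuous injection of Baire space into
   Cantor space. *)
pose gr (z : baire) : nat -> bool := fun j => let: (n, k) := Cantor.of_nat j in z n == k.
have gri : injective gr.
  move=> z z' e; apply/funext => n.
  have := congr1 (fun h => h (Cantor.to_nat (n, z n))) e.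
  by rewrite /gr Cantor.cancel_of_to eqxx => /esym/eqP.
have cgr : contB gr.
  move=> z j; exists (Cantor.of_nat j).1.+1 => z' zz'; rewrite /gr.
  by case: (Cantor.of_nat j) zz' => n k /= ->.
pose theta z := p (psi (gr z)).
have ctheta : contB theta by apply: contB_comp cp; apply: contB_comp cgr cpsi.
have /choice[g gP] : forall z, exists x, A x /\ theta z = c x.
  by move=> z; have [x [Ax e _]] := DA _ (Dpsi (gr z)); exists x.
exists g; split.
- move=> z z' e; apply/gri/psii; move/set_injP: ip; apply => //.
  by rewrite -/(theta z) -/(theta z') (gP z).2 (gP z').2 e.
- by move=> z; have [] := gP z.
- move=> _ /cP[B bB ->]; rewrite (_ : _ @^-1` _ = [set z | B (theta z)]).
    exact: contB_borelB.
  by apply/seteqP; split => z /=; rewrite (gP z).2.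
Qed.

End StandardBorel.
Local Open Scope card_scope.

(** * Cardinalities and coarse shapes *)

Lemma card_le_of_inj (T U : Type) (A : set T) (B : set U) (f : T -> U) :
    (forall x, A x -> B (f x)) -> (forall x y, A x -> A y -> f x = f y -> x = y) ->
  A #<= B.
Proof.
move=> AB fi; have [|g] := (@injfunPex _ _ A B).2; last exact: inj_card_le.
by exists f => // x y; rewrite !inE; apply: fi.
Qed.

Lemma inj_of_card_le (T U : Type) (A : set T) (B : set U) (u0 : U) : A #<= B ->
  exists f : T -> U, (forall x, A x -> B (f x)) /\
    (forall x y, A x -> A y -> f x = f y -> x = y).
Proof.
move=> /card_leP[g].
have /choice[f fP] : forall x, exists y, forall (Ax : x \in A),
    y = set_val (g (SigSub Ax : A)).
  move=> x; have [Ax|nA] := pselect (x \in A); last by exists u0.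
  by exists (set_val (g (SigSub Ax : A))) => Ax'; rewrite (bool_irrelevance Ax Ax').
exists f; split=> [x /mem_set Ax|x y /mem_set Ax /mem_set Ay].
  by rewrite (fP x Ax); apply: set_valP.
rewrite (fP x Ax) (fP y Ay) => /val_inj/(@inj _ _ _ g).
by rewrite !inE => /(_ I I) /(congr1 val).
Qed.

Lemma card_le_IP (T : eqType) (A : set T) k :
  `I_k #<= A <-> exists s : seq T, [/\ uniq s, size s = k & forall x, x \in s -> A x].
Proof.
split=> [IA|[s [us <- sA]]]; last first.
  case: s us sA => [_ _|a s us sA]; first by rewrite II0 card_ge0.
  apply: (@card_le_of_inj _ _ _ _ (nth a (a :: s))) => [i /= ik|i j /= ik jk /eqP].
    by apply: sA; apply: mem_nth.
  by rewrite nth_uniq // => /eqP.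
case: k IA => [_|k IA]; first by exists [::].
have [a Aa] : A !=set0.
  apply: contrapT => /set0P/negP/negPn/eqP A0; move: IA; rewrite A0 card_le0 => /eqP I0.
  by have : (set0 : set nat) 0%N by rewrite -I0.
have [f [fA fi]] := inj_of_card_le a IA.
exists (mkseq f k.+1); rewrite size_mkseq; split=> //.
  rewrite map_inj_in_uniq ?iota_uniq // => i j; rewrite !mem_iota => ik jk.
  exact: fi.
by move=> x /mapP[i]; rewrite mem_iota => ik ->; apply: fA.
Qed.

(** Comparisons of [ecard] reduce to embeddings of initial segments, which finite lists witness;
    over the naturals this is a countable condition. *)
Lemma ecard_ge (T : Type) (A : set T) k : le_enat (Some k) (ecard A) <-> `I_k #<= A.
Proof.
rewrite /ecard; case: pselect => [fA|infA] /=.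
  case: (cid fA) => n /= An; rewrite -(card_le_II k n); split => h.
    by apply: card_le_trans h _; move: An; rewrite card_eq_le => /andP[].
  by apply: card_le_trans h _; move: An; rewrite card_eq_le => /andP[].
split=> // _; move/infiniteP: infA; apply: card_le_trans; exact: card_leT.
Qed.

Lemma le_enatP (a b : enat) :
  le_enat a b <-> forall k, le_enat (Some k) a -> le_enat (Some k) b.
Proof.
case: a b => [i|] [j|] //=; split=> //.
- by move=> ij k ki; apply: leq_trans ij.
- by move=> /(_ i (leqnn i)).
- by move=> /(_ j.+1 isT); rewrite ltnn.
Qed.

Lemma le_enat_refl a : le_enat a a. Proof. by case: a => //= n. Qed.

Lemma le_enat_trans b a c : le_enat a b -> le_enat b c -> le_enat a c.
Proof. by move=> /le_enatP ab /le_enatP bc; apply/le_enatP => k /ab/bc. Qed.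

Lemma le_enat_anti a b : le_enat a b -> le_enat b a -> a = b.
Proof. by case: a b => [i|] [j|] //= ij ji; congr Some; apply/eqP; rewrite eqn_leq ij ji. Qed.

Lemma le_enat0 a : le_enat (Some 0%N) a. Proof. by case: a. Qed.

Lemma ecard_le (T U : Type) (A : set T) (B : set U) : A #<= B -> le_enat (ecard A) (ecard B).
Proof. by move=> AB; apply/le_enatP => k /ecard_ge IA; apply/ecard_ge; apply: card_le_trans AB. Qed.

Lemma ecard_sub (T : Type) (A B : set T) : A `<=` B -> le_enat (ecard A) (ecard B).
Proof. by move=> AB; apply/ecard_le/subset_card_le. Qed.

Lemma ecard_eq (T U : Type) (A : set T) (B : set U) : A #= B -> ecard A = ecard B.
Proof.
by rewrite card_eq_le => /andP[AB BA]; apply: le_enat_anti; apply: ecard_le.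
Qed.

Lemma ecard_infinite (T : Type) (A : set T) : ecard A = None <-> infinite_set A.
Proof. by rewrite /ecard; case: pselect. Qed.

Lemma sigma_ecard (T : Type) (S : set (set T)) (P : T -> nat -> Prop) :
    sigma_algebra [set: T] S -> (forall k, S [set x | P x k]) ->
  sigma_fun (S := S) (fun x => ecard [set k | P x k]).
Proof.
move=> sS SP e.
have Sge k : S [set x | le_enat (Some k) (ecard [set k | P x k])].
  rewrite (_ : [set x | _] = [set x | exists s : seq nat,
      (uniq s /\ size s = k) /\ forall r, r \in s -> P x r]).
    apply: (sigma_exists sS) => s; apply: (sigma_and sS); first exact: sigma_cst.
    by apply: (sigma_forall sS) => r; apply: (sigma_imply sS) => //; apply: sigma_cst.
  apply/seteqP; split => x /=; rewrite ecard_ge card_le_IP.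
    by move=> [s [us sk sP]]; exists s.
  by move=> [s [[us sk] sP]]; exists s.
rewrite (_ : [set x | _] = [set x | forall k,
    le_enat (Some k) e <-> le_enat (Some k) (ecard [set k | P x k])]).
  apply: (sigma_forall sS) => k; apply: (sigma_iff sS) => //; exact: sigma_cst.
apply/seteqP; split => x /= => [<- //|eP].
by apply: le_enat_anti; apply/le_enatP => k /eP.
Qed.

(** * Ranks of elements in sets of natural numbers *)

Section Rank.
Variable A : nat -> Prop.

Definition rank (n : nat) : nat := count (fun k => `[< A k >]) (iota 0 n).

Lemma rankS n : rank n.+1 = (rank n + `[< A n >])%N.
Proof. by rewrite /rank -addn1 iotaD count_cat /= addn0. Qed.

Lemma rank_le m n : (m <= n)%N -> (rank m <= rank n)%N.
Proof.
move=> /subnKC <-; elim: (n - m)%N => [|d ih]; first by rewrite addn0.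
by rewrite addnS rankS (leq_trans ih) // leq_addr.
Qed.

Lemma rank_inj m n : A m -> A n -> rank m = rank n -> m = n.
Proof.
have lt i j : A i -> (i < j)%N -> (rank i < rank j)%N.
  by move=> Ai /rank_le; apply: leq_trans; rewrite rankS (asboolT Ai) addn1.
move=> Am An e; case: (ltngtP m n) => // /lt.
  by move=> /(_ Am); rewrite e ltnn.
by move=> /(_ An); rewrite e ltnn.
Qed.

Lemma rank_lt n : A n -> le_enat (Some (rank n).+1) (ecard [set k | A k]).
Proof.
move=> An; apply/ecard_ge/card_le_IP.
exists [seq k <- iota 0 n.+1 | `[< A k >]]; split.
- by rewrite filter_uniq // iota_uniq.
- by rewrite size_filter -/(rank n.+1) rankS (asboolT An) addn1.
- by move=> k; rewrite mem_filter => /andP[/asboolP].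
Qed.

Lemma rank_onto i : le_enat (Some i.+1) (ecard [set k | A k]) -> exists2 n, A n & rank n = i.
Proof.
move=> /ecard_ge/card_le_IP[s [us ss sA]].
have ex : exists N, (i < rank N)%N.
  exists (foldr maxn 0%N s).+1; rewrite -ss /rank -size_filter.
  apply: uniq_leq_size => // k ks; rewrite mem_filter mem_iota /= add0n ltnS (asboolT (sA k ks)) /=.
  by elim: s ks {us ss sA} => //= a s ih; rewrite inE leq_max => /orP[/eqP ->|/ih ->]; rewrite ?leqnn ?orbT.
case: (ex_minnP ex) => -[//|n] iN Nmin; exists n.
  apply: contrapT => nA; have := Nmin n; rewrite ltnn; move: iN.
  by rewrite rankS (asboolF nA) addn0 => h /(_ h).
apply/eqP; rewrite eqn_leq; apply/andP; split.
  by rewrite leqNgt; apply/negP => /Nmin; rewrite ltnn.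
by move: iN; rewrite rankS; case: asbool; rewrite ?addn1 ?addn0 ?ltnS // => /ltnW.
Qed.

End Rank.

Lemma sigma_rank (T : Type) (S : set (set T)) (P : T -> nat -> Prop) n :
    sigma_algebra [set: T] S -> (forall k, S [set x | P x k]) ->
  sigma_fun (S := S) (fun x => rank (P x) n).
Proof.
move=> sS SP; elim: n => [|n ih] k; first exact: (sigma_cst sS (0%N = k)).
rewrite (_ : [set x | _] = [set x | P x n /\ (rank (P x) n).+1 = k \/
    ~ P x n /\ rank (P x) n = k]).
  apply: (sigma_or sS); apply: (sigma_and sS) => //; last exact: (sigma_not sS).
  exact: (sigma_fun_pred sS (fun j => j.+1 = k) ih).
apply/seteqP; split => x /=; rewrite rankS.
  by have [Pn|nP] := asboolP (P x n); rewrite ?addn1 ?addn0; [left|right].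
by case=> -[Pn]; rewrite ?(asboolT Pn) ?(asboolF Pn) ?addn1 ?addn0.
Qed.

(** * Counting classes, and monotonicity of shapes under embeddings *)

Lemma class_eqP (T : Type) (E : T -> T -> Prop) x y : Equivalence E ->
  E x y <-> [set z | E x z] = [set z | E y z].
Proof.
move=> eqE; split=> [xy|/seteqP[_ /(_ y) /= h]]; last by apply: h; reflexivity.
apply/seteqP; split => z /= xz; last by transitivity y.
by transitivity x => //; symmetry.
Qed.

(** Counts indices of representatives in place of classes, which brings the shape within reach of
    [sigma_ecard]. *)
Lemma lcs_count (T : Type) (E : T -> T -> Prop) (C : set T) (g : nat -> T) (P : nat -> Prop) m :
    Equivalence E -> (forall y z, C y -> E y z -> C z) ->
    (forall j, P j -> C (g j)) -> (forall i j, P i -> P j -> E (g i) (g j) -> i = j) ->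
    (forall y, C y -> exists2 j, P j & E (g j) y) ->
  lcs E C m = ecard [set j | P j /\ le_enat (sval m) (ecard [set y | E (g j) y])].
Proof.
move=> eqE CE PC Pi CP.
rewrite -(@ecard_eq _ _ ((fun j => [set y | E (g j) y]) @` _) _ (inj_card_eq _)); last first.
  by apply/set_injP => i j [Pi' _] [Pj _] /(class_eqP _ _ eqE); apply: Pi.
congr ecard; apply/seteqP; split => D /=.
  move=> [[x _ <-] xC mD]; have [|j Pj /(class_eqP _ _ eqE) e] := CP x.
    by apply: xC; rewrite /=; reflexivity.
  by exists j; rewrite e.
move=> [j [Pj mj] <-]; split=> //; first by exists (g j).
by move=> y /= gy; apply: CE gy; apply: PC.
Qed.

Lemma lcs_anti (T : Type) (E : T -> T -> Prop) (C : set T) (m m' : penat) :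
  le_enat (sval m) (sval m') -> le_enat (lcs E C m') (lcs E C m).
Proof.
move=> mm'; apply: ecard_sub => D [cD DC mD]; split=> //.
exact: le_enat_trans mm' mD.
Qed.

(** A class is sent to the saturation of its image, a single class at least as large. *)
Lemma lcs_embed (T U : Type) (E F : T -> T -> Prop) (E' F' : U -> U -> Prop) (f : T -> U) x :
    Equivalence E -> Equivalence E' -> injective f ->
    (forall y z, E' y z -> F' y z) -> Equivalence F' ->
    (forall x y, E x y <-> E' (f x) (f y)) -> (forall x y, F x y <-> F' (f x) (f y)) ->
  le_shape (lcs E [set y | F x y]) (lcs E' [set y | F' (f x) y]).
Proof.
move=> eqE eqE' fi EF' eqF' fE fF m; apply: ecard_le.
have im a : [set y | exists2 b, E a b & E' (f b) y] = [set y | E' (f a) y].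
  apply/seteqP; split => y /= => [[b /fE ab by_]|ay]; first by transitivity (f b).
  by exists a => //; reflexivity.
apply: (@card_le_of_inj _ _ _ _ (fun D => [set y | exists2 b, D b & E' (f b) y])).
  move=> _ [[a _ <-] aF ma]; rewrite im; split; first by exists (f a).
    move=> y /= ay; have /fF xa : F x a by apply: aF; rewrite /=; reflexivity.
    by transitivity (f a) => //; apply: EF'.
  apply: le_enat_trans ma _; apply: ecard_le.
  by apply: (@card_le_of_inj _ _ _ _ f) => [y /fE//|y z _ _ /fi].
move=> _ _ [[a _ <-] _ _] [[b _ <-] _ _]; rewrite !im => /(class_eqP _ _ eqE') e.
by apply/(class_eqP _ _ eqE)/fE.
Qed.

Lemma shape_classes_embed (T U : Type) (E F : T -> T -> Prop) (E' F' : U -> U -> Prop) (f : T -> U) W :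
    Equivalence E -> Equivalence E' -> Equivalence F -> Equivalence F' -> injective f ->
    (forall y z, E' y z -> F' y z) ->
    (forall y, Sc (lcs E' [set z | F' y z])) ->
    (forall x y, E x y <-> E' (f x) (f y)) -> (forall x y, F x y <-> F' (f x) (f y)) ->
  upper_set W -> shape_classes E F W #<= shape_classes E' F' W.
Proof.
move=> eqE eqE' eqF eqF' fi EF' ScY fE fF [_ upW].
have im a : [set y | exists2 b, F a b & F' (f b) y] = [set y | F' (f a) y].
  apply/seteqP; split => y /= => [[b /fF ab by_]|ay]; first by transitivity (f b).
  by exists a => //; reflexivity.
apply: (@card_le_of_inj _ _ _ _ (fun D => [set y | exists2 b, D b & F' (f b) y])).
  move=> _ [[a _ <-] Wa]; rewrite im; split; first by exists (f a).
  by apply: upW Wa _ _ => //; apply: lcs_embed.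
move=> _ _ [[a _ <-] _] [[b _ <-] _]; rewrite !im => /(class_eqP _ _ eqF') e.
by apply/(class_eqP _ _ eqF)/fF.
Qed.

(** * Coarse shapes are well-quasi-ordered *)

Lemma enat_min (I : Type) (P : I -> Prop) (f : I -> enat) : (exists i, P i) ->
  exists2 i, P i & forall j, P j -> le_enat (f i) (f j).
Proof.
move=> [i0 Pi0]; have [ex|nex] := pselect (exists n, `[< exists2 i, P i & f i = Some n >]).
  case: (ex_minnP ex) => n /asboolP[i Pi fi] nmin; exists i => // j Pj; rewrite fi.
  case E : (f j) => [k|//] /=; apply: nmin; apply/asboolP; by exists j.
exists i0 => // j Pj; case E : (f j) => [k|]; last by case: (f i0).
by exfalso; apply: nex; exists k; apply/asboolP; exists j.
Qed.

(** The form with a monotone subsequence passes to conjunctions of orders; [wqo_on] is the weaker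
    consequence that the matchings use. *)
Definition wq (T : Type) (le : T -> T -> Prop) := forall s : nat -> T,
  exists2 phi : nat -> nat, (forall i j, (i < j)%N -> (phi i < phi j)%N) &
    (forall i j, (i < j)%N -> le (s (phi i)) (s (phi j))).

Lemma increasing_ge (phi : nat -> nat) : (forall i j, (i < j)%N -> (phi i < phi j)%N) ->
  forall n, (n <= phi n)%N.
Proof. by move=> inc; elim=> // n ih; apply: leq_ltn_trans ih (inc _ _ _). Qed.

Lemma wq_enat : wq le_enat.
Proof.
move=> s; have /choice[f fP] : forall N, exists n, (N <= n)%N /\
    forall m, (N <= m)%N -> le_enat (s n) (s m).
  move=> N; have [|n Nn nmin] := @enat_min _ (fun n => (N <= n)%N) s; first by exists N.
  by exists n.
pose phi := fix phi n := if n is k.+1 then f (phi k).+1 else f 0%N.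
have inc i j : (i < j)%N -> (phi i < phi j)%N.
  elim: j => // j ih; rewrite ltnS leq_eqVlt => /orP[/eqP ->|/ih ij]; first exact: (fP _).1.
  by apply: ltn_trans ij _; apply: (fP _).1.
exists phi => // i j /inc ij; case: i ij => [|i] ij; apply: (fP _).2 => //.
by apply: leq_trans (ltnW ij); apply: (fP _).1.
Qed.

Lemma wq_comp (T U : Type) (le : U -> U -> Prop) (g : T -> U) :
  wq le -> wq (fun x y => le (g x) (g y)).
Proof. by move=> wle s; apply: (wle (g \o s)). Qed.

Lemma wq_and (T : Type) (le1 le2 : T -> T -> Prop) :
  wq le1 -> wq le2 -> wq (fun x y => le1 x y /\ le2 x y).
Proof.
move=> w1 w2 s; have [phi inc1 P1] := w1 s; have [psi inc2 P2] := w2 (s \o phi).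
exists (phi \o psi) => i j ij; first exact/inc1/inc2.
by split; [apply/P1/inc2|apply: P2].
Qed.

Lemma wq_forall (T : Type) (le : nat -> T -> T -> Prop) K :
  (forall k, wq (le k)) -> wq (fun x y => forall k, (k < K)%N -> le k x y).
Proof.
move=> wle; elim: K => [|K ih] s; first by exists id.
have [phi inc phiP] := wq_and ih (wle K) s; exists phi => // i j /phiP[h1 h2] k.
by rewrite ltnS leq_eqVlt => /orP[/eqP ->|/h1].
Qed.

Lemma down_closed_ecard (A : set nat) n : (forall i j, (i <= j)%N -> A j -> A i) ->
  A n <-> le_enat (Some n.+1) (ecard A).
Proof.
move=> dA; split=> [An|].
  by apply/ecard_ge/subset_card_le => i /= ilen; apply: dA An; rewrite -ltnS.
move=> /ecard_ge IA; apply: contrapT => nAn.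
suff /(card_le_trans IA) : A #<= `I_n by rewrite card_le_II ltnn.
by apply: subset_card_le => i Ai /=; rewrite ltnNge; apply/negP => /dA /(_ Ai).
Qed.

Lemma wq_down_closed (T : Type) (g : T -> set nat) :
  (forall x i j, (i <= j)%N -> g x j -> g x i) -> wq (fun x y => g x `<=` g y).
Proof.
move=> dg s; have [phi inc phiP] := wq_comp (fun x => ecard (g x)) wq_enat s.
exists phi => // i j /phiP le n /(down_closed_ecard _ (dg _)) gn.
by apply/(down_closed_ecard _ (dg _)); apply: le_enat_trans le.
Qed.

Definition antitone_shape (a : coarse_shape) := forall m m' : penat,
  le_enat (sval m) (sval m') -> le_enat (a m') (a m).

Definition fin_index (k : nat) : penat := exist _ (Some k.+1) isT.
Definition inf_index : penat := exist _ None isT.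

Lemma penat_cases (m : penat) : m = inf_index \/ exists k, m = fin_index k.
Proof.
case: m => -[[|k]|] mP //; last by left; apply: val_inj.
by right; exists k; apply: val_inj.
Qed.

(** The Young diagram of a shape: more than [n] classes have at least [k+1] elements, so that both
    coordinates start at 0. *)
Definition diagram (a : coarse_shape) (k n : nat) : Prop := le_enat (Some n.+1) (a (fin_index k)).

Lemma le_shape_diagram a b : le_enat (a inf_index) (b inf_index) ->
  (forall k n, diagram a k n -> diagram b k n) -> le_shape a b.
Proof.
move=> ab dab m; have [->//|[k ->]] := penat_cases m.
apply/le_enatP => -[|n]; [by rewrite !le_enat0|exact: dab].
Qed.

Lemma diagram_down a k n k' n' : antitone_shape a -> (k' <= k)%N -> (n' <= n)%N ->
  diagram a k n -> diagram a k' n'.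
Proof.
move=> aa kk nn akn; apply: (@le_enat_trans (Some n.+1)) => //.
by apply: le_enat_trans akn (aa _ _ _).
Qed.

Lemma diagram_box a : antitone_shape a -> exists K, forall k n, diagram a k n ->
  [\/ forall k', diagram a k' n, forall n', diagram a k n' | (k < K)%N /\ (n < K)%N].
Proof.
move=> aa; have [all|] := pselect (forall k n, diagram a k n).
  by exists 0%N => k n _; apply: Or31.
(* A missing cell forces [k < k0] or [n < n0] throughout the diagram; each of these finitely many
   rows and columns is full or bounded. *)
move=> /existsNP[k0 /existsNP[n0 nd]].
have [i m m' mm'|i _|M1 M1P] := @uniform_bound n0 (fun i m =>
    (forall k', diagram a k' i) \/ forall k, diagram a k i -> (k < m)%N).
- by case=> [|h]; [left|right => k /h /leq_trans]; [|apply].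
- have [|/existsNP[k' nk]] := pselect (forall k', diagram a k' i).
    by exists 0%N; left.
  exists k'; right=> k dk; rewrite ltnNge; apply/negP => kk'.
  by apply: nk; apply: diagram_down dk.
have [i m m' mm'|i _|M2 M2P] := @uniform_bound k0 (fun i m =>
    (forall n', diagram a i n') \/ forall n, diagram a i n -> (n < m)%N).
- by case=> [|h]; [left|right => k /h /leq_trans]; [|apply].
- have [|/existsNP[k' nk]] := pselect (forall n', diagram a i n').
    by exists 0%N; left.
  exists k'; right=> k dk; rewrite ltnNge; apply/negP => kk'.
  by apply: nk; apply: diagram_down dk.
exists (maxn (maxn M1 M2) (maxn k0 n0)) => k n dkn.
case: (ltnP n n0) => nn0.
  have [|/(_ _ dkn) kM] := M1P n nn0; first exact: Or31.
  by apply: Or33; lia.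
case: (ltnP k k0) => kk0; last by exfalso; apply: nd; apply: diagram_down dkn.
have [|/(_ _ dkn) kM] := M2P k kk0; first exact: Or32.
by apply: Or33; lia.
Qed.

Definition wqo_on (Q : Type) (G : set Q) (le : Q -> Q -> Prop) :=
  forall s : nat -> Q, (forall i, G (s i)) ->
    exists i, forall N, exists2 j, (N <= j)%N & le (s i) (s j).

Lemma wq_wqo_on (Q : Type) (G : set Q) (le : Q -> Q -> Prop) : wq le -> wqo_on G le.
Proof.
move=> wle s _; have [phi inc phiP] := wle s; exists (phi 0%N) => N.
exists (phi N.+1); last exact: phiP.
exact: leq_trans (leqnSn N) (increasing_ge inc _).
Qed.

(* If the diagrams avoid a fixed square they are determined by finitely many
   rows and columns; otherwise they eventually contain every square, and only
   the infinite rows and columns of the first one matter. *)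
Lemma antitone_shape_wqo : wqo_on antitone_shape le_shape.
Proof.
move=> s sa.
have wrow n : wq (fun i j => [set k | diagram (s i) k n] `<=` [set k | diagram (s j) k n]).
  by apply: wq_down_closed => i k k' kk' /=; apply: diagram_down.
have wcol k : wq (fun i j => [set n | diagram (s i) k n] `<=` [set n | diagram (s j) k n]).
  by apply: wq_down_closed => i n n' nn' /=; apply: diagram_down.
have winf : wq (fun i j => le_enat (s i inf_index) (s j inf_index)).
  exact: (wq_comp (fun i => s i inf_index) wq_enat).
have [[K /choice[t tP]]|] := pselect (exists K, forall N, exists j, (N <= j)%N /\ ~ diagram (s j) K K).
  have [phi inc phiP] := wq_and winf (wq_and (wq_forall K wrow) (wq_forall K wcol)) t.
  exists (t (phi 0%N)) => N; have [infN [rowN colN]] := phiP 0%N N.+1 isT.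
  exists (t (phi N.+1)).
    apply: leq_trans (tP _).1; apply: leq_trans (increasing_ge inc _); exact: leqnSn.
  apply: le_shape_diagram => // k n dkn; case: (ltnP n K) => nK; first exact: (rowN n nK k).
  case: (ltnP k K) => kK; first exact: (colN k kK n).
  exfalso; apply: (tP (phi 0%N)).2; exact: diagram_down dkn.
move=> /forallNP box.
have wfull : wq (fun i j => [set n | forall k, diagram (s i) k n] `<=`
    [set n | forall k, diagram (s j) k n]).
  by apply: wq_down_closed => i n n' nn' /= h k; apply: diagram_down (h k).
have wcols : wq (fun i j => [set k | forall n, diagram (s i) k n] `<=`
    [set k | forall n, diagram (s j) k n]).
  by apply: wq_down_closed => i k k' kk' /= h n; apply: diagram_down (h n).
have [phi inc phiP] := wq_and winf (wq_and wfull wcols) id.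
(* Apart from full rows and columns the first diagram fits in a square of side [K], which all late
   diagrams contain. *)
have [K KP] := diagram_box (sa (phi 0%N)).
have [M MP] : exists M, forall j, (M <= j)%N -> diagram (s j) K K.
  have /existsNP[M /forallNP MP] := box K; exists M => j Mj.
  by apply: contrapT => nd; apply: (MP j).
exists (phi 0%N) => N; pose j := (maxn N M).+1; exists (phi j).
  by apply: leq_trans (increasing_ge inc _); rewrite /j; lia.
have [infN [fullN colN]] := phiP 0%N j isT.
apply: le_shape_diagram => // k n /KP[/fullN|/colN|[kK nK]]; [exact|exact|].
apply: (diagram_down (sa _) (ltnW kK) (ltnW nK)); apply: MP.
by apply: leq_trans (increasing_ge inc _); rewrite /j; lia.
Qed.

Lemma Sc_antitone a : Sc a -> antitone_shape a.
Proof. by move=> [T [E [_ _ _ ->]]] m m'; apply: lcs_anti. Qed.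

(** A non-increasing sequence in [enat] is eventually constant: a prefix, the final value and the
    value at omega determine the shape. *)
Lemma Sc_countable : countable Sc.
Proof.
pose dec (p : seq enat * enat * enat) : coarse_shape := fun m =>
  if sval m is Some k then nth p.1.2 p.1.1 k.-1 else p.2.
suff sub : Sc `<=` range dec.
  apply: sub_countable (subset_card_le sub) _.
  by apply: sub_countable (card_image_le _ _) _; apply: countableP.
move=> a /Sc_antitone aa.
have [|K _ Kmin] := @enat_min _ (fun _ : nat => True) (fun k => a (fin_index k)).
  by exists 0%N.
exists (mkseq (fun k => a (fin_index k)) K, a (fin_index K), a inf_index) => //.
apply/funext => m; have [->//|[k ->]] := penat_cases m; rewrite /dec /=.
case: (ltnP k K) => kK; first by rewrite nth_mkseq.
rewrite nth_default ?size_mkseq //; apply: le_enat_anti; first exact: Kmin.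
exact: aa.
Qed.

Lemma le_shape_refl a : le_shape a a.
Proof. by move=> m; apply: le_enat_refl. Qed.

Lemma le_shape_trans b a c : le_shape a b -> le_shape b c -> le_shape a c.
Proof. by move=> ab bc m; apply: le_enat_trans (bc m). Qed.

(** * Matchings *)

Section Hall.
Implicit Types (w : nat -> nat -> Prop) (s : seq nat).

Definition many_neighbours w s k := exists t, [/\ uniq t, size t = k &
  forall r, r \in t -> exists2 l, l \in s & w l r].

Definition hall_condition w s := forall s', uniq s' -> {subset s' <= s} ->
  many_neighbours w s' (size s').

Lemma many_neighbours_le w s k k' : (k' <= k)%N -> many_neighbours w s k -> many_neighbours w s k'.
Proof.
move=> kk [t [ut st tw]]; exists (take k' t); split; first exact: take_uniq.
  by rewrite size_take_min st; apply/minn_idPl.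
by move=> r /mem_take/tw.
Qed.

Theorem hall w s : uniq s -> hall_condition w s ->
  exists h : nat -> nat, (forall l, l \in s -> w l (h l)) /\ {in s &, injective h}.
Proof.
move: {2}(size s) (leqnn (size s)) => n; elim: n w s => [|n ih] w s.
  by rewrite leqn0 => /nilP -> _ _; exists id.
move=> sn us hs.
(* Tight case: all neighbours of [s1] lie in [t]. The rest is matched outside [t], where Hall's
   condition survives because it holds for [s1 ++ s']. *)
have [[s1 [us1 s1s s10 s1n tight]]|loose] := pselect (exists s1, [/\ uniq s1,
    {subset s1 <= s}, (0 < size s1)%N, (size s1 < size s)%N &
    ~ many_neighbours w s1 (size s1).+1]).
  have [t [ut st tw]] := hs s1 us1 s1s.
  have wt l r : l \in s1 -> w l r -> r \in t.
    move=> ls wlr; apply: contraPT isT => nrt _; apply: tight; exists (r :: t).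
    rewrite /= nrt ut st; split=> // r'; rewrite inE => /orP[/eqP ->|/tw//].
    by exists l.
  have [||h1 [h1w h1i]] := ih w s1 _ us1.
  - by rewrite -ltnS (leq_trans s1n).
  - by move=> s' us' ss'; apply: hs => // x /ss'/s1s.
  pose s2 := [seq l <- s | l \notin s1]; pose w2 l r := w l r /\ r \notin t.
  have s2P l : (l \in s2) = (l \notin s1) && (l \in s) by rewrite mem_filter.
  have [|||h2 [h2w h2i]] := ih w2 s2.
  - rewrite -ltnS (leq_trans _ sn) // size_filter ltnNge; apply/negP => h.
    have : all (fun l => l \notin s1) s by rewrite all_count eqn_leq count_size.
    case: s1 s10 {us1 s1n tight st tw wt h1w h1i s2 s2P h} s1s => // a s1 _ s1s /allP /(_ a).
    by move=> /(_ (s1s a (mem_head _ _))); rewrite mem_head.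
  - exact: filter_uniq.
  - move=> s' us' ss'.
    have [||t' [ut' st' t'w]] := hs (s1 ++ s').
    + rewrite cat_uniq us1 us' andbT; apply/hasPn => l /ss'.
      by rewrite s2P => /andP[].
    + move=> l; rewrite mem_cat => /orP[/s1s//|/ss']; by rewrite s2P => /andP[].
    apply: (@many_neighbours_le _ _ (size [seq r <- t' | r \notin t])).
      have le_t : (count (mem t) t' <= size t)%N.
        rewrite -size_filter; apply: uniq_leq_size; first exact: filter_uniq.
        by move=> r; rewrite mem_filter => /andP[].
      rewrite size_filter (eq_count (a2 := predC (mem t))) //.
      rewrite -(leq_add2l (count (mem t) t')) count_predC st' size_cat -st.
      by rewrite leq_add2r.
    eexists; split; [|reflexivity|]; first exact: filter_uniq.
    move=> r; rewrite mem_filter => /andP[nrt /t'w[l]]; rewrite mem_cat => /orP[ls1|ls'] wlr.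
      by rewrite (wt l r) in nrt.
    by exists l.
  exists (fun l => if l \in s1 then h1 l else h2 l); split.
    move=> l ls; case: ifPn => ls1; first exact: h1w.
    by have [] := h2w l; rewrite // s2P ls1.
  have h2t l : l \in s -> l \notin s1 -> h2 l \notin t.
    by move=> ls ls1; have [] := h2w l; rewrite // s2P ls1.
  move=> l l' ls ls'; case: ifPn => l1; case: ifPn => l1'.
  - exact: h1i.
  - by move=> e; have := h2t _ ls' l1'; rewrite -e (wt l) //; apply: h1w.
  - by move=> e; have := h2t _ ls l1; rewrite e (wt l') //; apply: h1w.
  - by apply: h2i; rewrite s2P ?l1 ?l1'.
(* Loose case: proper nonempty subsets have a neighbour to spare, so one vertex can be matched
   arbitrarily and its partner deleted. *)
case: s sn us hs loose => [|a s] sn us hs loose; first by exists id.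
have [//||t [ut st tw]] := hs [:: a]; first by move=> l; rewrite !inE => ->.
case: t ut st tw => // r t _ _ /(_ r (mem_head _ _)) [l]; rewrite inE => /eqP -> war.
move: us; rewrite /= => /andP[nas us].
have [//||h [hw hi]] := ih (fun l r' => w l r' /\ r' <> r) s _ us.
  move=> s' us' ss'; case: (posnP (size s')) => [/size0nil ->|s'0]; first by exists [::].
  have [t' [ut' st' t'w]] : many_neighbours w s' (size s').+1.
    apply: contrapT => nm; apply: loose; exists s'; split=> //.
      by move=> l' /ss'; rewrite inE orbC => ->.
    by rewrite /= ltnS; apply: uniq_leq_size.
  apply: (@many_neighbours_le _ _ (size (rem r t'))).
    by case: (boolP (r \in t')) => [rt|/rem_id ->]; rewrite ?(size_rem rt) st'.
  exists (rem r t'); split=> //; first exact: rem_uniq.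
  move=> r'; rewrite mem_rem_uniq // inE => /andP[/eqP r'r /t'w[l' l's' wl]].
  by exists l'.
exists (fun l' => if l' == a then r else h l'); split.
  by move=> l'; rewrite inE; case: eqP => [-> //|_] /= /hw[].
have hr l' : l' \in s -> h l' <> r by move=> /hw[].
move=> l1 l2; rewrite !inE; case: eqP => [->|_]; case: eqP => [->|_] //=.
- by move=> _ /hr e /esym.
- by move=> /hr.
- exact: hi.
Qed.

End Hall.

(** * Greedy matchings that depend measurably on a parameter *)

Section Greedy.
Variables (act : nat -> Prop) (w : nat -> nat -> Prop).

Definition finite_degree l := act l /\ exists N, forall r, w l r -> (r < N)%N.

Definition is_matching (p : seq (nat * nat)) :=
  uniq (unzip1 p) && uniq (unzip2 p) /\ forall q, q \in p -> w q.1 q.2.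

(** Taken with [least] among the countably many lists, so that it varies measurably with the
    graph. *)
Definition greedy_start : seq (nat * nat) := least [::] (fun p =>
  is_matching p /\ forall l, finite_degree l -> l \in unzip1 p).

Definition greedy_step (p : seq (nat * nat)) n : seq (nat * nat) :=
  if pselect (act n /\ n \notin unzip1 p)
  then (n, least 0%N (fun r => w n r /\ r \notin unzip2 p)) :: p else p.

Fixpoint greedy_list n :=
  if n is k.+1 then greedy_step (greedy_list k) k else greedy_start.

Definition greedy l : nat := least 0%N (fun r => exists n, (l, r) \in greedy_list n).

Hypothesis finite_core : exists N, forall l, (N <= l)%N -> ~ finite_degree l.
Hypothesis hall_w : forall s, uniq s -> (forall l, l \in s -> act l) -> many_neighbours w s (size s).

Lemma greedy_startP : is_matching greedy_start /\
  forall l, finite_degree l -> l \in unzip1 greedy_start.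
Proof.
apply: (@least_in _ _ (fun p => is_matching p /\ forall l, finite_degree l -> l \in unzip1 p)).
have [N NP] := finite_core.
pose s := [seq l <- iota 0 N | `[< finite_degree l >]].
have sP l : l \in s <-> finite_degree l.
  rewrite mem_filter mem_iota /= add0n; split=> [/andP[/asboolP]//|fl].
  by rewrite (asboolT fl) /= ltnNge; apply/negP => /NP.
have us : uniq s by rewrite filter_uniq ?iota_uniq.
have [|h [hw hi]] := @hall w s us.
  by move=> s' us' ss'; apply: hall_w => // l /ss'/sP[].
have u1 : unzip1 [seq (l, h l) | l <- s] = s by rewrite /unzip1 -map_comp map_id.
exists [seq (l, h l) | l <- s]; split; last by move=> l /sP; rewrite u1.
split; last by move=> q /mapP[l ls ->]; apply: hw.
by rewrite u1 us /unzip2 -map_comp /= map_inj_in_uniq.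
Qed.

Lemma greedy_listP n : is_matching (greedy_list n) /\
  forall l, finite_degree l -> l \in unzip1 (greedy_list n).
Proof.
elim: n => [|n [[/andP[u1 u2] pw] pf]]; first exact: greedy_startP.
rewrite /= /greedy_step; case: pselect => [[an nn]|np]; last by split=> //; split=> //; rewrite u1 u2.
(* Vertices of finite degree are matched from the start; an unmatched one has neighbours outside any
   finite list. *)
have nf : ~ finite_degree n by move=> /pf; rewrite (negbTE nn).
have ex : exists r, w n r /\ r \notin unzip2 (greedy_list n).
  apply: contrapT => nex; apply: nf; split=> //.
  exists (foldr maxn 0%N (unzip2 (greedy_list n))).+1 => r wr.
  have : r \in unzip2 (greedy_list n).
    by apply: contraPT isT => nr _; apply: nex; exists r.
  by rewrite ltnS; elim: (unzip2 _) => //= a s ih; rewrite inE leq_max => /orP[/eqP ->|/ih ->];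
    rewrite ?leqnn ?orbT.
have [wr nr] := least_in 0%N ex; split.
  split; first by rewrite /= nn u1 nr u2.
  by move=> q; rewrite inE => /orP[/eqP ->|/pw].
by move=> l /pf; rewrite inE orbC => ->.
Qed.

Lemma greedy_list_le m n : (m <= n)%N -> {subset greedy_list m <= greedy_list n}.
Proof.
move=> /subnKC <-; elim: (n - m)%N => [|d ih] q; first by rewrite addn0.
move=> /ih; rewrite addnS /= /greedy_step; case: pselect => // an.
by rewrite inE orbC => ->.
Qed.

Lemma greedy_in l : act l -> exists n, (l, greedy l) \in greedy_list n.
Proof.
move=> al; apply: (@least_in _ _ (fun r => exists n, (l, r) \in greedy_list n)).
have : l \in unzip1 (greedy_list l.+1).
  rewrite /= /greedy_step; case: pselect => [an|/not_andP[//|/negP/negPn//]].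
  by rewrite /= mem_head.
by move=> /mapP[[l' r] lr /= ->]; exists r, l.+1.
Qed.

Lemma greedy_edge l : act l -> w l (greedy l).
Proof. by move=> /greedy_in[n]; have [[_ pw] _] := greedy_listP n; apply: pw. Qed.

Lemma greedy_inj l l' : act l -> act l' -> greedy l = greedy l' -> l = l'.
Proof.
move=> /greedy_in[n ln] /greedy_in[n' ln'] e.
have {}ln := greedy_list_le (leq_maxl n n') ln.
have {}ln' := greedy_list_le (leq_maxr n n') ln'.
have [[/andP[_ u2] _] _] := greedy_listP (maxn n n').
move: ln'; rewrite -e; elim: (greedy_list _) u2 ln => // -[a b] p ih /= /andP[nb u2].
rewrite !inE => /orP[/eqP[ea eb]|lp] /orP[/eqP[ea' eb']|lp'].
- by rewrite ea ea'.
- by case/negP: nb; rewrite -eb; apply/mapP; exists (l', greedy l).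
- by case/negP: nb; rewrite -eb'; apply/mapP; exists (l, greedy l).
- exact: ih.
Qed.

End Greedy.

Lemma sigma_greedy (T : Type) (S : set (set T)) (act : T -> nat -> Prop)
    (w : T -> nat -> nat -> Prop) (l : nat) :
    sigma_algebra [set: T] S -> (forall l, S [set x | act x l]) ->
    (forall l r, S [set x | w x l r]) ->
  sigma_fun (S := S) (fun x => greedy (act x) (w x) l).
Proof.
move=> sS Sact Sw.
have Sstart : sigma_fun (S := S) (fun x => greedy_start (act x) (w x)).
  apply: sigma_least => // p; apply: (sigma_and sS).
    apply: (sigma_and sS); first exact: sigma_cst.
    by apply: (sigma_forall sS) => q; apply: (sigma_imply sS) => //; apply: sigma_cst.
  apply: (sigma_forall sS) => k; apply: (sigma_imply sS); last exact: sigma_cst.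
  apply: (sigma_and sS) => //; apply: (sigma_exists sS) => N; apply: (sigma_forall sS) => r.
  by apply: (sigma_imply sS) => //; apply: sigma_cst.
have Slist n : sigma_fun (S := S) (fun x => greedy_list (act x) (w x) n).
  elim: n => [|n ih] //= p.
  apply: (sigma_fun_comp sS (P := fun p' x => greedy_step (act x) (w x) p' n = p) ih) => p'.
  apply: (sigma_fun_if sS) => [|q|q].
  - by apply: (sigma_and sS) => //; apply: sigma_cst.
  - apply: (sigma_fun_pred sS (fun r => (n, r) :: p' = q)).
    apply: sigma_least => // r; apply: (sigma_and sS) => //; exact: sigma_cst.
  - exact: sigma_cst.
apply: sigma_least => // r; apply: (sigma_exists sS) => n.
exact: (sigma_fun_pred sS (fun p : seq (nat * nat) => (l, r) \in p) (Slist n)).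
Qed.

Lemma infinite_nat_unbounded (A : set nat) :
  (forall N, exists2 n, (N <= n)%N & A n) -> infinite_set A.
Proof.
move=> Ainf [n An]; have : `I_n.+1 #<= A.
  have infA k : `I_k #<= A.
    apply/card_le_IP; elim: k => [|k [s [us sk sA]]]; first by exists [::].
    have [m ms Am] := Ainf (foldr maxn 0%N s).+1; exists (m :: s); split.
    - rewrite /= us andbT; apply/negP => min.
      suff : (m <= foldr maxn 0%N s)%N by rewrite leqNgt ms.
      by elim: s min {us sk sA ms} => //= a s ih; rewrite inE leq_max => /orP[/eqP ->|/ih ->];
        rewrite ?leqnn ?orbT.
    - by rewrite /= sk.
    - by move=> r; rewrite inE => /orP[/eqP ->|/sA].
  exact: infA.
by rewrite (card_le_eqr An) card_le_II ltnn.
Qed.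

(* A well-quasi-order on the labels confines the vertices of finite degree to
   a finite set: infinitely many would contain one whose upper set, hence whose
   neighbourhood, is infinite. *)
Lemma labelled_matching (Q : Type) (G : set Q) (le : Q -> Q -> Prop) (u v : nat -> Q)
    (act act' : nat -> Prop) :
    (forall q, le q q) -> wqo_on G le ->
    (forall l, act l -> G (u l)) ->
    (forall s : seq nat, (forall l, l \in s -> act l) ->
      le_enat (ecard [set l | act l /\ exists2 k, k \in s & le (u k) (u l)])
              (ecard [set r | act' r /\ exists2 k, k \in s & le (u k) (v r)])) ->
  let w l r := act' r /\ le (u l) (v r) in
  (forall l, act l -> w l (greedy act w l)) /\
  (forall l l', act l -> act l' -> greedy act w l = greedy act w l' -> l = l').
Proof.
move=> refl wqo aG card w.
have fin : exists N, forall l, (N <= l)%N -> ~ finite_degree act w l.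
  apply: contrapT => /forallNP inf.
  have /choice[t tP] : forall N, exists l, (N <= l)%N /\ finite_degree act w l.
    move=> N; have /existsNP[l /not_implyP[Nl /contrapT fl]] := inf N.
    by exists l.
  have [i|i iP] := wqo (u \o t); first by apply: aG; have [_ []] := tP i.
  have [_ [ai [N NP]]] := tP i.
  have ai' l : l \in [:: t i] -> act l by rewrite inE => /eqP ->.
  have := card [:: t i] ai'; rewrite (ecard_infinite _).2; last first.
    apply: infinite_nat_unbounded => M; have [j Mj uij] := iP M.
    exists (t j); first by apply: leq_trans Mj (tP j).1.
    by split; [have [_ []] := tP j|exists (t i); rewrite ?inE].
  case E : (ecard _) => [n|] // _; move/ecard_infinite: E; apply; apply: (@sub_finite_set _ _ `I_N); last exact: finite_II.
  by move=> r /= [ar [k]]; rewrite inE => /eqP -> ler; apply: NP.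
(* By reflexivity [s] lies in the left-hand set of [card], so the right-hand set contains [size s]
   neighbours. *)
have hal s : uniq s -> (forall l, l \in s -> act l) -> many_neighbours w s (size s).
  move=> us sa; have /le_enatP/(_ (size s)) := card s sa; rewrite !ecard_ge !card_le_IP.
  case; first by exists s; split=> // l ls; split; [exact: sa|exists l].
  move=> t [ut st tP]; exists t; split=> // r /tP[ar [k ks kr]].
  by exists k.
split=> [l|l l']; [exact: greedy_edge|exact: greedy_inj].
Qed.

(** Sizes are linearly ordered: the labels above some member of [s] are those above its least label,
    and the hypothesis at that size gives the bound. Label 0 marks an index that stands for no
    class. *)
Lemma size_matching (u v : nat -> enat) :
    (forall m : penat, le_enat (ecard [set r | le_enat (sval m) (u r)])
                               (ecard [set r | le_enat (sval m) (v r)])) ->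
  let h := greedy (fun l => u l <> Some 0%N) (fun l r => True /\ le_enat (u l) (v r)) in
  (forall l, u l <> Some 0%N -> le_enat (u l) (v (h l))) /\
  (forall l l', u l <> Some 0%N -> u l' <> Some 0%N -> h l = h l' -> l = l').
Proof.
move=> uv.
have [||//|s sa|h1 h2] := @labelled_matching enat setT le_enat u v
    (fun l => u l <> Some 0%N) (fun _ => True).
- exact: le_enat_refl.
- exact/wq_wqo_on/wq_enat.
- case: s sa => [|a s] sa.
    by apply: ecard_sub => l [_ [k]].
  have [|k ks kmin] := @enat_min _ (fun k => k \in a :: s) u; first by exists a; apply: mem_head.
  have uk : u k != Some 0%N by apply/eqP/sa.
  apply: le_enat_trans (le_enat_trans (uv (exist _ (u k) uk)) _); apply: ecard_sub => l /=.
    by move=> [_ [j /kmin kj]]; apply: le_enat_trans.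
  by move=> kl; split=> //; exists k.
- by split=> // l /h1[].
Qed.

(** * Enumerating the classes of a smooth relation *)

Lemma smooth_baire (R : realType) (X : standardBorelType R) (F : X -> X -> Prop) :
  smooth F -> exists2 f : X -> baire, borel_map f & forall x y, F x y <-> f x = f y.
Proof.
move=> [Z [g [bg gF]]]; have [c [ci _ cP]] := standard_borel_encodes Z.
exists (c \o g) => [B bB|x y]; last by rewrite gF /=; split=> [->//|/ci].
by rewrite comp_preimage; apply/bg/cP; exists B.
Qed.

(* [nu] numbers the points of each class injectively, and [sg n x] is the point
   numbered [n] in the class of [x] (some point of the class if there is none). *)
Definition class_enum (R : realType) (X : standardBorelType R) (F : X -> X -> Prop)
    (nu : X -> nat) (sg : nat -> X -> X) :=
  [/\ sigma_fun (S := borel X) nu, forall n, borel_fun (sg n), forall n x, F x (sg n x) &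
      forall x y, F x y -> sg (nu y) x = y].

Theorem smooth_class_enum (R : realType) (X : standardBorelType R) (F : X -> X -> Prop) :
  cber F -> smooth F -> exists nu sg, class_enum F nu sg.
Proof.
move=> [eqF _ cF] /smooth_baire[f bf fF]; have sX := borel_sigma X.
have [|A [bA Ai Acov]] := lusin_novikov bf.
  move=> x; rewrite (_ : [set y | _] = [set y | F x y]) //.
  by apply/seteqP; split => y /fF.
pose nu x := least 0%N (fun n => A n x).
have nuA x : A (nu x) x by apply: (@least_in _ _ (fun n => A n x)).
have nuS : sigma_fun (S := borel X) nu by apply: sigma_least.
have nui x y : f x = f y -> nu x = nu y -> x = y.
  by move=> fxy nxy; apply: (Ai (nu x)) => //; rewrite nxy.
(* [f] is injective on the points numbered [n], so their image is Borel by Lusin-Souslin and the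
   saturation is its preimage. *)
have bsat n B : borel X B -> borel X [set x | exists2 y, B y /\ nu y = n & f y = f x].
  move=> bB; apply: (bf [set z | exists2 y, B y /\ nu y = n & f y = z]).
  apply: (borelB_inj_image_of (A := [set y | B y /\ nu y = n])) => //.
    exact: (sigma_and sX).
  by move=> x y [_ nx] [_ ny] fxy; apply: nui => //; rewrite nx ny.
have /choice[sg sgP] : forall p : nat * X, exists y : X,
    (f y = f p.2 /\ nu y = p.1) \/ y = p.2 /\ ~ exists2 z, True /\ nu z = p.1 & f z = f p.2.
  move=> [n x] /=; have [[y [_ ny] fy]|nex] :=
    pselect (exists2 z, True /\ nu z = n & f z = f x); first by exists y; left.
  by exists x; right.
have fsg n x : f (sg (n, x)) = f x.
  by have [[]|[-> _]] := sgP (n, x).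
exists nu, (fun n x => sg (n, x)); split=> //.
- move=> n B bB; rewrite (_ : _ @^-1` _ = [set x | (exists2 y, B y /\ nu y = n & f y = f x) \/
    (~ (exists2 z, True /\ nu z = n & f z = f x)) /\ B x]).
    apply: (sigma_or sX); first exact: bsat.
    apply: (sigma_and sX) => //; apply: (sigma_not sX).
    by apply: (bsat n setT); apply: (sigma_cst sX True).
  apply/seteqP; split => x /=.
    move=> Bx; have [[/= fy ny]|[/= e nex]] := sgP (n, x); first by left; exists (sg (n, x)).
    by right; rewrite e in Bx.
  case=> [[y [By ny] fy]|[nex Bx]]; have [[/= fy' ny']|[/= e nex']] := sgP (n, x).
  + suff -> : sg (n, x) = y by [].
    by apply: nui; rewrite ?ny' ?fy'.
  + by exfalso; apply: nex'; exists y.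
  + by exfalso; apply: nex; exists (sg (n, x)).
  + by rewrite e.
- by move=> n x; apply/fF; rewrite fsg.
- move=> x y /fF fxy; have [[/= fy ny]|[/= e nex]] := sgP (nu y, x).
    by apply: nui => //; rewrite fy.
  by exfalso; apply: nex; exists y.
Qed.

(** * Classes, sizes and shapes as Borel data *)

Section ClassData.
Variables (R : realType) (X : standardBorelType R) (E F : X -> X -> Prop).
Hypotheses (cberE : cber E) (cberF : cber F) (EF : forall x y, E x y -> F x y).
Variable fE : X -> baire.
Hypotheses (bfE : borel_map fE) (fEP : forall x y, E x y <-> fE x = fE y).
Variables (nu : X -> nat) (sg : nat -> X -> X).
Hypothesis enumF : class_enum F nu sg.

Let sX := borel_sigma X.
Let eqE : Equivalence E. Proof. by case: cberE. Qed.
Let eqF : Equivalence F. Proof. by case: cberF. Qed.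
#[local] Existing Instance eqE.
#[local] Existing Instance eqF.

(** The first conjunct discards default values of the selector. *)
Definition members (x : X) (n : nat) := nu (sg n x) = n /\ E x (sg n x).

Definition class_size (x : X) : enat := ecard [set y | E x y].

Definition rep_index (x : X) : nat := least 0%N (members x).

Definition class_rank (x : X) : nat := rank (members x) (nu x).

(** Only indices fixed by [rep_index] stand for an [E]-class; classes being nonempty, 0 is free to
    mark the others. *)
Definition size_label (x : X) (r : nat) : enat :=
  if pselect (rep_index (sg r x) = r) then class_size (sg r x) else Some 0%N.

Lemma membersP x n : members x n <-> exists2 y, E x y & nu y = n.
Proof.
have [_ _ Fsg sgK] := enumF; split=> [[nx Ex]|[y Exy <-]]; first by exists (sg n x).
by rewrite /members sgK //; apply: EF.
Qed.

Lemma members_nu x : members x (nu x).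
Proof. by apply/membersP; exists x => //; reflexivity. Qed.

Lemma members_eq x y : E x y -> members x = members y.
Proof.
move=> xy; apply/seteqP; split => n /membersP[z Ez nz]; apply/membersP; exists z => //.
  by transitivity x => //; symmetry.
by transitivity y.
Qed.

(** A selector is constant on a class wherever its value is not a default. *)
Lemma sg_valid x y n : F x y -> nu (sg n x) = n -> sg n y = sg n x.
Proof.
have [_ _ Fsg sgK] := enumF => xy nx; rewrite -{1}nx; apply: sgK.
by transitivity x => //; symmetry.
Qed.

Lemma rep_index_mem x : members x (rep_index x).
Proof. by apply: (@least_in _ _ (members x)); exists (nu x); apply: members_nu. Qed.

Lemma rep_index_E x y : E x y -> rep_index x = rep_index y.
Proof. by move=> /members_eq e; rewrite /rep_index e. Qed.

Lemma rep_index_inj x y : F x y -> rep_index x = rep_index y -> E x y.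
Proof.
move=> xy e; have [nx Ex] := rep_index_mem x; have [ny Ey] := rep_index_mem y.
rewrite -e (sg_valid xy nx) in Ey; transitivity (sg (rep_index x) x) => //.
by symmetry.
Qed.

Lemma rep_indexK x : rep_index (sg (rep_index x) x) = rep_index x.
Proof. by apply/esym/rep_index_E; have [] := rep_index_mem x. Qed.

Lemma rep_valid x r : rep_index (sg r x) = r -> nu (sg r x) = r.
Proof.
have [_ _ Fsg sgK] := enumF; move=> e; have [] := rep_index_mem (sg r x); rewrite e => n1 _.
have -> // : sg r x = sg r (sg r x).
by apply: sg_valid => //; symmetry; apply: Fsg.
Qed.

Lemma class_size_E x y : E x y -> class_size x = class_size y.
Proof. by move=> /(class_eqP _ _ eqE) e; rewrite /class_size e. Qed.

Lemma class_sizeE x : class_size x = ecard [set n | members x n].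
Proof.
have [_ _ _ sgK] := enumF.
rewrite /class_size -(@ecard_eq _ _ (nu @` [set y | E x y]) _ (inj_card_eq _)); last first.
  by apply/set_injP => y z /EF xy /EF xz e; rewrite -(sgK x y) // e sgK.
congr ecard; apply/seteqP; split => n /=; rewrite membersP.
  by move=> [y]; exists y.
by move=> [y]; exists y.
Qed.

Lemma class_size_neq0 x : class_size x <> Some 0%N.
Proof.
rewrite class_sizeE => e; have := rank_lt (members_nu x); rewrite e //.
Qed.

Lemma size_label_rep x r : size_label x r <> Some 0%N ->
  rep_index (sg r x) = r /\ size_label x r = class_size (sg r x).
Proof. by rewrite /size_label; case: pselect. Qed.

Lemma size_label_rep_index x : size_label x (rep_index x) = class_size x.
Proof.
rewrite /size_label; case: pselect => [e|]; last by rewrite rep_indexK.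
by apply/esym/class_size_E; have [] := rep_index_mem x.
Qed.

Lemma size_label_F x y : F x y -> size_label x = size_label y.
Proof.
have [_ _ Fsg sgK] := enumF.
have sub a b r : F a b -> rep_index (sg r a) = r -> sg r b = sg r a.
  by move=> ab /rep_valid; apply: sg_valid.
move=> xy; apply/funext => r; rewrite /size_label.
case: pselect => [e|ne]; case: pselect => [e'|ne'] //.
- by rewrite /= (sub x y).
- by exfalso; apply: ne'; rewrite (sub x y).
- have yx : F y x by symmetry.
  by exfalso; apply: ne; rewrite (sub y x).
Qed.

Lemma lcs_size_label x m :
  lcs E [set y | F x y] m = ecard [set r | le_enat (sval m) (size_label x r)].
Proof.
have [_ _ Fsg sgK] := enumF.
rewrite (@lcs_count _ _ _ (sg^~ x) (fun r => rep_index (sg r x) = r)) //.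
- congr ecard; apply/seteqP; split => r /=; rewrite /size_label.
    by move=> [e h]; case: pselect.
  case: pselect => [e h|ne]; first by split.
  (* [m] is at least 1, so the label 0 is never counted. *)
  by case: m => -[[|k]|].
- by move=> y z /= xy /EF yz; transitivity y.
- by move=> j _; apply: Fsg.
- by move=> i j ei ej /rep_index_E; rewrite ei ej.
- move=> y /= xy; exists (rep_index y).
    have [ny _] := rep_index_mem y; have yx : F y x by symmetry.
    by rewrite (sg_valid yx ny) rep_indexK.
  have [ny Ey] := rep_index_mem y; have yx : F y x by symmetry.
  by rewrite (sg_valid yx ny); symmetry.
Qed.

Lemma lcs_Sc x : Sc (lcs E [set y | F x y]).
Proof.
have [_ _ Fsg sgK] := enumF.
pose T := {y | F x y}; pose ET (a b : T) := E (sval a) (sval b).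
have eqET : Equivalence ET.
  split; [move=> a|move=> a b ab|move=> a b c ab bc]; rewrite /ET.
  - by reflexivity.
  - by symmetry.
  - by transitivity (sval b).
have FE a y : F x a -> E a y -> F x y by move=> xa /EF ay; transitivity a.
exists T, ET; split=> //.
- have [_ _ /(_ x)/countable_injP[g gi]] := cberF.
  apply/countable_injP; exists (g \o sval) => a b _ _ /= e.
  case: a b e => [a aP] [b bP] /= e; have {}e : a = b by apply: gi; rewrite ?inE.
  by subst b; congr exist; apply: Prop_irrelevance.
- by exists (exist _ x (reflexivity x)).
apply/funext => m; rewrite lcs_size_label.
rewrite (@lcs_count _ _ _ (fun r => exist _ (sg r x) (Fsg r x) : T)
  (fun r => rep_index (sg r x) = r)) //.
- congr ecard; apply/seteqP; split => r /=; rewrite /size_label.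
    case: pselect => [e h|ne]; last by case: m => -[[|k]|].
    split=> //; apply: le_enat_trans h _; apply: ecard_le.
    apply: (@card_le_trans _ _ _ (sval @` [set y : T | ET (exist _ (sg r x) (Fsg r x)) y])).
      apply: subset_card_le => y /= Ey; have Fy := FE _ _ (Fsg r x) Ey.
      by exists (exist _ y Fy).
    exact: card_image_le.
  move=> [e h]; case: pselect => //= e'; apply: le_enat_trans h _; apply: ecard_le.
  apply: (@card_le_of_inj _ _ _ _ sval) => //.
  move=> [a aP] [b bP] _ _ /= ab; subst b; congr exist; exact: Prop_irrelevance.
- by move=> i j ei ej /rep_index_E /=; rewrite ei ej.
- move=> [y xy] _; exists (rep_index y).
    have [ny _] := rep_index_mem y; have yx : F y x by symmetry.
    by rewrite (sg_valid yx ny) rep_indexK.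
  have [ny Ey] := rep_index_mem y; have yx : F y x by symmetry.
  by rewrite /ET /= (sg_valid yx ny); symmetry.
Qed.

Lemma class_rank_inj x y : E x y -> class_rank x = class_rank y -> x = y.
Proof.
have [_ _ Fsg sgK] := enumF; move=> xy; rewrite /class_rank -(members_eq xy) => e.
have ny : members x (nu y) by rewrite (members_eq xy); apply: members_nu.
have := rank_inj (members_nu x) ny e => nxy.
by rewrite -(sgK x x) ?nxy ?sgK //; [apply: EF|reflexivity].
Qed.

Lemma class_rank_lt x : le_enat (Some (class_rank x).+1) (class_size x).
Proof. by rewrite class_sizeE; apply: rank_lt; apply: members_nu. Qed.

Lemma class_rank_onto x i : le_enat (Some i.+1) (class_size x) ->
  exists n, members x n /\ class_rank (sg n x) = i.
Proof.
rewrite class_sizeE => /rank_onto[n mn rn]; exists n; split=> //.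
by have [nn En] := mn; rewrite /class_rank nn -(members_eq En).
Qed.

Lemma sigma_members n : borel X [set x | members x n].
Proof.
have [bnu bsg _ _] := enumF; apply: (sigma_and sX); first exact: (bsg n [set y | nu y = n]).
rewrite (_ : [set x | _] = [set x | forall p : nat * nat,
    fE x p.1 = p.2 <-> fE (sg n x) p.1 = p.2]).
  apply: (sigma_forall sX) => p.
  have bp : borel X [set x | fE x p.1 = p.2].
    by apply: (bfE (B := [set z | z p.1 = p.2])); apply: borelB_coord.
  by apply: (sigma_iff sX) => //; apply: (bsg n _ bp).
apply/seteqP; split => x /=; first by move=> /fEP ->.
by move=> h; apply/fEP/funext => i; apply/esym/(h (i, fE x i)).
Qed.

Lemma sigma_rep_index : sigma_fun (S := borel X) rep_index.
Proof. by apply: sigma_least => //; apply: sigma_members. Qed.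

Lemma sigma_class_size : sigma_fun (S := borel X) class_size.
Proof.
move=> k; rewrite (_ : [set x | _] = [set x | ecard [set n | members x n] = k]).
  exact: (sigma_ecard sX sigma_members).
by apply/seteqP; split => x /=; rewrite class_sizeE.
Qed.

Lemma sigma_size_label r : sigma_fun (S := borel X) (fun x => size_label x r).
Proof.
have [_ bsg _ _] := enumF; apply: (sigma_fun_if sX) => [|k|k].
- exact: (bsg r _ (sigma_rep_index r)).
- exact: (bsg r _ (sigma_class_size k)).
- exact: sigma_cst.
Qed.

Lemma sigma_class_rank : sigma_fun (S := borel X) class_rank.
Proof.
have [bnu _ _ _] := enumF; move=> i.
apply: (sigma_fun_comp sX (P := fun n x => rank (members x) n = i) bnu) => n.
exact: (sigma_rank n sX sigma_members).
Qed.

Lemma sigma_lcs a : borel X [set x | lcs E [set y | F x y] = a].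
Proof.
rewrite (_ : [set x | _] = [set x | forall m : penat,
    ecard [set r | le_enat (sval m) (size_label x r)] = a m]).
  apply: (sigma_forall sX) => m.
  apply: (@sigma_ecard _ _ (fun x r => le_enat (sval m) (size_label x r))) => // r.
  exact: (sigma_fun_pred sX (fun e => le_enat (sval m) e) (sigma_size_label r)).
apply/seteqP; split => x /=; first by move=> <- m; rewrite lcs_size_label.
by move=> h; apply/funext => m; rewrite lcs_size_label.
Qed.

Definition transversal_pt (x : X) : X := sg (least 0%N (fun n => nu (sg n x) = n)) x.

Lemma transversal_pt_F x y : F x y -> transversal_pt x = transversal_pt y.
Proof.
have [_ _ Fsg sgK] := enumF; rewrite /transversal_pt => xy.
have P a b : F a b -> (fun n => nu (sg n a) = n) `<=` (fun n => nu (sg n b) = n).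
  by move=> ab n na; rewrite (sg_valid ab na).
have -> : (fun n => nu (sg n x) = n) = (fun n => nu (sg n y) = n).
  by apply/seteqP; split; apply: P => //; symmetry.
apply/esym/sg_valid => //.
have : nu (sg (nu x) x) = nu x by rewrite sgK //; reflexivity.
move=> h; have /least_in : exists n, nu (sg n y) = n by exists (nu x); apply: (P x y).
move=> /(_ 0%N) h'; apply: (P y x) => //; by symmetry.
Qed.

Lemma transversal_pt_in x : F x (transversal_pt x).
Proof. by have [_ _ Fsg _] := enumF; apply: Fsg. Qed.

Lemma sigma_transversal : borel X [set x | transversal_pt x = x].
Proof.
have [bnu bsg Fsg sgK] := enumF.
(* A point is fixed exactly when its number is the least one in its class. *)
rewrite (_ : [set x | _] = [set x | forall m, (fun n x => least 0%N (fun n => nu (sg n x) = n) = n -> nu x = n) m x]).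
  apply: (sigma_forall sX) => m; apply: (sigma_imply sX); last exact: bnu.
  by apply: sigma_least => // n; apply: (bsg n [set y | nu y = n]).
have val x : nu (transversal_pt x) = least 0%N (fun n => nu (sg n x) = n).
  by apply: (@least_in _ _ (fun n => nu (sg n x) = n)); exists (nu x); rewrite sgK //; reflexivity.
apply/seteqP; split => x /= => [e m <-|/(_ _ erefl) h]; first by rewrite -val e.
have Fxx : F x x by reflexivity.
by have := sgK x x Fxx; rewrite [in X in X -> _]h.
Qed.

End ClassData.

(** * Embedding from shapes *)

Lemma borel_countable (R : realType) (X : standardBorelType R) (A : set X) :
  countable A -> borel X A.
Proof.
move=> cA; have sX := borel_sigma X; have [c [ci _ cP]] := standard_borel_encodes X.
rewrite (_ : A = [set x | exists2 y, A y & x = y]); last first.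
  by apply/seteqP; split => x /= => [Ax|[y Ay ->]//]; exists x.
apply: (sigma_exists_in sX cA) => y _; apply/cP.
exists [set z | forall i, z i = c y i].
  by apply: (sigma_forall borelB_sigma) => i; apply: borelB_coord.
apply/seteqP; split => x /= => [-> //|e]; apply: ci; exact/funext.
Qed.

Definition upper_of (a : coarse_shape) : set coarse_shape := [set b | Sc b /\ le_shape a b].

Section Embedding.
Variables (R : realType) (X Y : standardBorelType R).
Variables (E F : X -> X -> Prop) (E' F' : Y -> Y -> Prop).
Hypotheses (cberE : cber E) (cberF : cber F) (EF : forall x y, E x y -> F x y).
Hypotheses (cberE' : cber E') (cberF' : cber F') (EF' : forall x y, E' x y -> F' x y).
Variables (fE fF : X -> baire) (fE' : Y -> baire).
Hypotheses (bfE : borel_map fE) (fEP : forall x y, E x y <-> fE x = fE y).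
Hypotheses (bfF : borel_map fF) (fFP : forall x y, F x y <-> fF x = fF y).
Hypotheses (bfE' : borel_map fE') (fEP' : forall x y, E' x y <-> fE' x = fE' y).
Variables (nu : X -> nat) (sg : nat -> X -> X) (nu' : Y -> nat) (sg' : nat -> Y -> Y).
Hypotheses (enumF : class_enum F nu sg) (enumF' : class_enum F' nu' sg').
Hypothesis gle : gcs_le E F E' F'.

Let sX := borel_sigma X.
Let sY := borel_sigma Y.
Let eqE : Equivalence E. Proof. by case: cberE. Qed.
Let eqF : Equivalence F. Proof. by case: cberF. Qed.
Let eqE' : Equivalence E'. Proof. by case: cberE'. Qed.
Let eqF' : Equivalence F'. Proof. by case: cberF'. Qed.
#[local] Existing Instance eqE.
#[local] Existing Instance eqF.
#[local] Existing Instance eqE'.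
#[local] Existing Instance eqF'.

Let shape x := lcs E [set y | F x y].
Let shape' y := lcs E' [set z | F' y z].

Let shape_Sc x : Sc (shape x). Proof. exact: (lcs_Sc cberE cberF EF enumF). Qed.

Let shape_F x y : F x y -> shape x = shape y.
Proof. by move=> /(class_eqP _ _ eqF) e; rewrite /shape e. Qed.
Let shape_F' x y : F' x y -> shape' x = shape' y.
Proof. by move=> /(class_eqP _ _ eqF') e; rewrite /shape' e. Qed.

Let inhabited_target (x : X) : exists y : Y, True.
Proof.
have SU : upper_set Sc by split=> // a b _.
have /card_leP[g] := gle SU.
have Cx : [set y | F x y] \in shape_classes E F Sc.
  by rewrite inE; split; [exists x|exact: shape_Sc].
have := set_valP (g (SigSub Cx : shape_classes E F Sc)).
by move=> [[y _ _] _]; exists y.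
Qed.

Let V : set coarse_shape := [set a | Sc a /\ countable (shape_classes E' F' (upper_of a))].

Let V_upper : upper_set V.
Proof.
split=> [a []//|a b [Sa ca] Sb ab]; split=> //; apply: sub_countable ca.
apply: subset_card_le => C [cC [SC bC]]; split=> //; split=> //.
exact: le_shape_trans bC.
Qed.

Let V_countable' : countable (shape_classes E' F' V).
Proof.
have : countable (\bigcup_(a in V) shape_classes E' F' (upper_of a)).
  apply: bigcup_countable; last by move=> a [].
  by apply: sub_countable Sc_countable; apply: subset_card_le => a [].
apply: sub_countable; apply: subset_card_le => C [cC VC]; exists (lcs E' C) => //.
by split=> //; split; [case: VC|exact: le_shape_refl].
Qed.

Let V_countable : countable (shape_classes E F V).
Proof. exact: sub_countable (gle V_upper) V_countable'. Qed.

(** Targets of shape in [V] stay apart from those of the remaining classes. Measurability is not an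
    issue on this part, which covers only countably many points. *)
Let countable_part : exists m : X -> Y,
  (forall x, V (shape x) -> V (shape' (m x)) /\ le_shape (shape x) (shape' (m x))) /\
  (forall x x', F x x' -> m x = m x') /\
  (forall x x', V (shape x) -> V (shape x') -> F' (m x) (m x') -> F x x').
Proof.
have [[x0 _]|nX] := pselect (exists x : X, True); last first.
  have em (x : X) : False by apply: nX; exists x.
  by exists (fun x => match em x with end); split=> [x|]; [case: (em x)|split=> x; case: (em x)].
have [y0 _] := inhabited_target x0.
have /countable_injP[k /set_injP ki] := V_countable.
have /countable_injP[k' /set_injP ki'] := V_countable'.
pose act l := exists2 C, shape_classes E F V C & k C = l.
pose act' r := exists2 C, shape_classes E' F' V C & k' C = r.
have /choice[cl clP] : forall l, exists C, act l -> shape_classes E F V C /\ k C = l.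
  by move=> l; have [[C VC kC]|na] := pselect (act l); [exists C|exists set0].
have /choice[cl' clP'] : forall r, exists C, act' r -> shape_classes E' F' V C /\ k' C = r.
  by move=> l; have [[C VC kC]|na] := pselect (act' l); [exists C|exists set0].
pose u l := lcs E (cl l); pose v r := lcs E' (cl' r).
have uk C : shape_classes E F V C -> u (k C) = lcs E C.
  move=> VC; have [VC' e] := clP (k C) (ex_intro2 _ _ C VC erefl).
  by rewrite /u (ki (cl (k C)) C).
have vk C : shape_classes E' F' V C -> v (k' C) = lcs E' C.
  move=> VC; have [VC' e] := clP' (k' C) (ex_intro2 _ _ C VC erefl).
  by rewrite /v (ki' (cl' (k' C)) C).
have [|||s sa|hE hI] := @labelled_matching _ antitone_shape le_shape u v act act'.
- exact: le_shape_refl.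
- exact: antitone_shape_wqo.
- by move=> l /clP[[_ [Sa _]] _]; apply: Sc_antitone.
(* [W] is the upper set generated by the labels of [s]. It lies in [V], so its classes are among
   those enumerated, and the hypothesis at [W] gives the required bound. *)
- pose W := [set q | Sc q /\ exists2 j, j \in s & le_shape (u j) q].
  have WU : upper_set W.
    split=> [q []//|a b [_ [j js ja]] Sb ab]; split=> //; exists j => //.
    exact: le_shape_trans ab.
  have WV q : W q -> V q.
    move=> [Sq [j js jq]]; have [[_ Vj] _] := clP j (sa j js).
    by case: V_upper => _ up; apply: up Vj Sq jq.
  apply: ecard_le; apply: (card_le_trans _ (card_le_trans (gle WU) _)).
    apply: (@card_le_of_inj _ _ _ _ cl).
      move=> l [al [j js jl]]; have [[cC [SC _]] _] := clP l al.
      by split=> //; split=> //; exists j.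
    move=> l l' [al _] [al' _] e; have [_ <-] := clP l al; have [_ <-] := clP l' al'.
    by rewrite e.
  apply: (@card_le_of_inj _ _ _ _ k') => [C [cC WC]|C C' [cC WC] [cC' WC']].
    have VC : shape_classes E' F' V C by split=> //; apply: WV.
    split; first by exists C.
    by rewrite (vk C VC); case: WC => _ [j js jC]; exists j.
  by apply: ki'; split=> //; apply: WV.
set w := (fun l r => act' r /\ le_shape (u l) (v r)) in hE hI.
have /choice[g gP] : forall C, exists y, shape_classes E F V C ->
    [/\ V (shape' y), le_shape (lcs E C) (shape' y) &
        shape_classes E' F' V [set z | F' y z] /\
        k' [set z | F' y z] = greedy act w (k C)].
  move=> C; have [VC|nV] := pselect (shape_classes E F V C); last by exists y0.
  have [[_ [[y _ <-] VC'] <-] le] := hE (k C) (ex_intro2 _ _ C VC erefl).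
  exists y => _; split=> //; last by split=> //; split=> //; exists y.
  by move: le; rewrite uk // vk //; split=> //; exists y.
have clV x : V (shape x) -> shape_classes E F V [set y | F x y].
  by move=> Vx; split=> //; exists x.
exists (fun x => g [set y | F x y]); split.
  by move=> x /clV/gP[].
split=> [x x' /(class_eqP _ _ eqF) -> //|x x' /clV Vx /clV Vx'].
have [_ _ [V1 e1]] := gP _ Vx; have [_ _ [V2 e2]] := gP _ Vx'.
move=> /(class_eqP _ _ eqF') e; apply/(class_eqP _ _ eqF); apply: ki => //.
apply: hI; [by exists [set y | F x y]|by exists [set y | F x' y]|].
by rewrite -e1 -e2 e.
Qed.

Let pt' := transversal_pt nu' sg'.
Let slice b := [set y | pt' y = y /\ shape' y = b].

(** Shapes above [a] are countably many. If each were in [V] or had a countable slice, each would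
    account for countably many classes, and [a] would be in [V]. *)
Let uncountable_part a : Sc a -> ~ V a ->
  exists b, [/\ le_shape a b, ~ V b & ~ countable (slice b)].
Proof.
move=> Sa nVa; apply: contrapT => nex; apply: nVa; split=> //.
have cl_slice b : countable (slice b) ->
    countable [set C | classes F' C /\ lcs E' C = b].
  move=> cb; apply: sub_countable (subset_card_le _) (sub_countable
    (card_image_le (fun y => [set z | F' y z]) (slice b)) cb).
  move=> _ [[y _ <-] yb]; exists (pt' y).
    have e := transversal_pt_in enumF' y.
    split; last by rewrite -yb; apply/esym/shape_F'.
    exact/esym/(transversal_pt_F cberF' enumF').
  by apply/(class_eqP _ _ eqF'); symmetry; apply: (transversal_pt_in enumF').
have cU b : upper_of a b -> countable [set C | classes F' C /\ lcs E' C = b].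
  move=> [Sb ab]; have [cb|ub] := pselect (countable (slice b)); first exact: cl_slice.
  have [[_ Vb]|nVb] := pselect (V b); last by exfalso; apply: nex; exists b.
  apply: sub_countable Vb; apply: subset_card_le => C [cC Cb]; split=> //.
  by rewrite Cb; split=> //; apply: le_shape_refl.
have : countable (\bigcup_(b in upper_of a) [set C | classes F' C /\ lcs E' C = b]).
  apply: bigcup_countable => //.
  by apply: sub_countable Sc_countable; apply: subset_card_le => b [].
by apply: sub_countable; apply: subset_card_le => C [cC uC]; exists (lcs E' C).
Qed.

Let global_map : exists Phi : X -> Y, [/\ borel_fun Phi,
  forall x x', F x x' -> Phi x = Phi x', forall x x', F' (Phi x) (Phi x') -> F x x' &
  forall x, le_shape (shape x) (shape' (Phi x))].
Proof.
have [m [mV [mF mF']]] := countable_part.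
have [[x0 _]|nX] := pselect (exists x : X, True); last first.
  have em (x : X) : False by apply: nX; exists x.
  exists (fun x => match em x with end); split=> [B _|x|x|x]; try by case: (em x).
  by rewrite (_ : _ @^-1` _ = set0); [case: sX|apply/seteqP; split => x; case: (em x)].
have [y0 _] := inhabited_target x0.
have /choice[beta betaP] : forall a, exists b, Sc a -> ~ V a ->
    [/\ le_shape a b, ~ V b & ~ countable (slice b)].
  move=> a; have [[Sa nVa]|na] := pselect (Sc a /\ ~ V a).
    by have [b bP] := uncountable_part Sa nVa; exists b.
  by exists a => Sa nVa; exfalso; apply: na.
have /choice[psi psiP] : forall b, exists p : baire -> Y, ~ countable (slice b) ->
    [/\ injective p, forall z, slice b (p z) & forall B, borel Y B -> borelB (p @^-1` B)].
  move=> b; have [cb|ub] := pselect (countable (slice b)); first by exists (fun _ => y0).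
  have [|p pP] := perfect_set _ ub; last by exists p.
  apply: (sigma_and sY); first exact: (sigma_transversal cberF' enumF').
  exact: (sigma_lcs cberE' cberF' EF' bfE' fEP' enumF').
pose Phi x := if pselect (V (shape x)) then m x else psi (beta (shape x)) (fF x).
have PhiV x : V (shape x) -> Phi x = m x by rewrite /Phi; case: pselect.
have PhiN x : ~ V (shape x) -> Phi x = psi (beta (shape x)) (fF x).
  by rewrite /Phi; case: pselect.
have sliceN x : ~ V (shape x) -> slice (beta (shape x)) (Phi x) /\ ~ V (shape' (Phi x)).
  move=> nV; have [_ nVb ub] := betaP _ (shape_Sc x) nV; have [_ sl _] := psiP _ ub.
  rewrite PhiN //; split; first exact: sl.
  by have [_ ->] := sl (fF x).
exists Phi; split.
- move=> B bB; rewrite (_ : _ @^-1` _ = [set x | V (shape x) /\ B (m x) \/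
      exists2 a, [set a | Sc a /\ ~ V a] a & shape x = a /\ B (psi (beta a) (fF x))]).
    apply: (sigma_or sX).
      (* This part is a countable union of countable classes, so any subset of it is Borel. *)
      apply: borel_countable.
      apply: (@sub_countable _ _ _ (\bigcup_(C in shape_classes E F V) C)).
        apply: subset_card_le => x [Vx _]; exists [set y | F x y]; last by rewrite /=; reflexivity.
        by split=> //; exists x.
      apply: bigcup_countable => // _ [[x _ <-] _].
      by case: cberF.
    apply: (sigma_exists_in sX).
      by apply: sub_countable Sc_countable; apply: subset_card_le => a [].
    move=> a [Sa nVa]; apply: (sigma_and sX).
      exact: (sigma_lcs cberE cberF EF bfE fEP enumF).
    have [_ _ ub] := betaP a Sa nVa; have [_ _ bpsi] := psiP _ ub.
    by apply: (bfF (B := psi (beta a) @^-1` B)); apply: bpsi.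
  apply/seteqP; split => x /=.
    have [Vx|nVx] := pselect (V (shape x)); first by rewrite PhiV //; left.
    by rewrite PhiN // => Bx; right; exists (shape x).
  case=> [[Vx Bx]|[a [_ nV] [ea Bx]]]; first by rewrite PhiV.
  by rewrite -ea in nV Bx; rewrite PhiN.
- by move=> x x' xx; rewrite /Phi (shape_F xx) (mF _ _ xx); have /fFP -> := xx.
(* Whether the target shape is in [V] tells which definition of [Phi] applied. Outside [V] the
   target shape is the value of [beta], so related targets come from the same [psi], even when the
   source shapes differ. *)
- move=> x x' xx; have e := shape_F' xx.
  have [Vx|nVx] := pselect (V (shape x)); have [Vx'|nVx'] := pselect (V (shape x')).
  + by move: xx; rewrite !PhiV //; apply: mF'.
  + have [_] := sliceN _ nVx'; rewrite -e PhiV // => nV.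
    by exfalso; apply: nV; have [] := mV x Vx.
  + have [_] := sliceN _ nVx; rewrite e PhiV // => nV.
    by exfalso; apply: nV; have [] := mV x' Vx'.
  + have [[p1 s1] _] := sliceN _ nVx; have [[p2 s2] _] := sliceN _ nVx'.
    have eb : beta (shape x) = beta (shape x') by rewrite -s1 -s2 e.
    have := transversal_pt_F cberF' enumF' xx; rewrite -/pt' p1 p2 !PhiN // -eb.
    have [_ _ ub] := betaP _ (shape_Sc x) nVx; have [pi _ _] := psiP _ ub.
    by move=> /pi/fFP.
- move=> x; have [Vx|nVx] := pselect (V (shape x)).
    by rewrite PhiV //; have [] := mV x Vx.
  have [[_ ->] _] := sliceN x nVx.
  by have [] := betaP _ (shape_Sc x) nVx.
Qed.

Theorem embedding_of_gcs_le : pair_embeds E F E' F'.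
Proof.
have [Phi [bPhi PhiF PhiF' Phi_le]] := global_map.
have [_ bsg Fsg sgK] := enumF; have [_ bsg' Fsg' sgK'] := enumF'.
pose u x := size_label E nu sg x; pose v x := size_label E' nu' sg' (Phi x).
have uv x (mm : penat) : le_enat (ecard [set r | le_enat (sval mm) (u x r)])
                       (ecard [set r | le_enat (sval mm) (v x r)]).
  rewrite -(lcs_size_label cberE cberF EF enumF) -(lcs_size_label cberE' cberF' EF' enumF').
  exact: Phi_le.
pose H x := greedy (fun l => u x l <> Some 0%N) (fun l r => True /\ le_enat (u x l) (v x r)).
pose rho x := rep_index E nu sg x.
pose h x := H x (rho x).
pose y0 x := sg' (h x) (Phi x).
have u0 x : u x (rho x) <> Some 0%N.
  rewrite /u /rho (size_label_rep_index cberE EF enumF).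
  exact: (class_size_neq0 cberE EF enumF).
have y0P x : rep_index E' nu' sg' (y0 x) = h x /\ le_enat (class_size E x) (class_size E' (y0 x)).
  have [h1 _] := size_matching (uv x).
  have := h1 _ (u0 x); rewrite {1}/u /rho (size_label_rep_index cberE EF enumF).
  rewrite -/(rho x) -/(H x) -/(h x) => le.
  have [|e1 e2] := @size_label_rep _ _ E' nu' sg' (Phi x) (h x).
    move=> e; move: le; rewrite /v e; have := @class_size_neq0 _ _ _ _ cberE EF _ _ enumF x.
    by case: (class_size E x) => [[|n]|].
  by split=> //; rewrite -e2.
(* Inside the matched [E']-class the image is the point of equal rank, which exists because that
   class is at least as large. *)
pose P x n := members E' nu' sg' (y0 x) n /\
  class_rank E' nu' sg' (sg' n (y0 x)) = class_rank E nu sg x.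
pose N x := least 0%N (P x).
have NP x : P x (N x).
  apply: (@least_in _ _ (P x)); apply: (class_rank_onto cberE' EF' enumF').
  by apply: le_enat_trans (y0P x).2; apply: (class_rank_lt cberE EF enumF).
pose g x := sg' (N x) (y0 x).
have Eg x : E' (y0 x) (g x) by have [[]] := NP x.
have Fg x : F' (Phi x) (g x).
  by transitivity (y0 x); [exact: Fsg'|exact/EF'/Eg].
have gF x x' : F' (g x) (g x') -> F x x'.
  move=> gg; apply: PhiF'; transitivity (g x); first exact: Fg.
  by transitivity (g x') => //; symmetry.
(* Both sides of the graph depend only on the [F]-class, so related points share one matching and
   its injectivity can be applied. *)
have H_F x x' : F x x' -> H x = H x'.
  by move=> xx; rewrite /H /u /v (PhiF _ _ xx) (size_label_F cberE cberF EF enumF xx).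
have gE x x' : E' (g x) (g x') -> E x x'.
  move=> gg; have xx : F x x' by apply: gF; apply: EF'.
  apply: (rep_index_inj cberE cberF EF enumF xx).
  have [_ hI] := size_matching (uv x).
  have ux' : u x (rho x') <> Some 0%N.
    by rewrite /u (size_label_F cberE cberF EF enumF xx); apply: u0.
  apply: (hI _ _ (u0 x) ux'); rewrite -/(H x) -/(h x) (H_F _ _ xx) -/(h x').
  rewrite -(y0P x).1 -(y0P x').1; apply: (rep_index_E cberE' EF' enumF').
  transitivity (g x); first exact: Eg.
  by transitivity (g x') => //; symmetry; apply: Eg.
have E_y0 x x' : E x x' -> y0 x = y0 x'.
  move=> xx; have xxF := EF xx.
  by rewrite /y0 /h (H_F _ _ xxF) (PhiF _ _ xxF) /rho (rep_index_E cberE EF enumF xx).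
(* For fixed indices all maps are compositions of selectors with [Phi]; the Borel indices [h] and
   [N] are substituted afterwards. *)
have Sh : sigma_fun (S := borel X) h.
  move=> r; apply: (sigma_fun_comp sX (P := fun l x => H x l = r)
    (sigma_rep_index bfE fEP enumF)) => l.
  apply: (@sigma_greedy _ _ (fun x l => u x l <> Some 0%N)
    (fun x l r => True /\ le_enat (u x l) (v x r)) l sX) => {r l} [l|l r].
    apply: (sigma_not sX); exact: (sigma_size_label EF bfE fEP enumF).
  apply: (sigma_and sX); first exact: sigma_cst.
  apply: (sigma_fun_comp sX (P := fun e x => le_enat e (v x r))
    (sigma_size_label EF bfE fEP enumF l)) => e.
  apply: (sigma_fun_pred sX (fun e' => le_enat e e')) => e'.
  exact: (bPhi _ (sigma_size_label EF' bfE' fEP' enumF' r e')).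
have SN : sigma_fun (S := borel X) N.
  apply: (sigma_least _ sX) => n.
  apply: (sigma_fun_comp sX (P := fun r x => members E' nu' sg' (sg' r (Phi x)) n /\
    class_rank E' nu' sg' (sg' n (sg' r (Phi x))) = class_rank E nu sg x) Sh) => r.
  apply: (sigma_and sX).
    exact: (bPhi _ (bsg' r _ (sigma_members bfE' fEP' enumF' n))).
  apply: (sigma_fun_comp sX (P := fun i x => class_rank E' nu' sg' (sg' n (sg' r (Phi x))) = i)
    (sigma_class_rank bfE fEP enumF)) => i.
  exact: (bPhi _ (bsg' r _ (bsg' n _ (sigma_class_rank bfE' fEP' enumF' i)))).
have EgE x x' : E x x' <-> E' (g x) (g x').
  split=> [xx|]; last exact: gE.
  transitivity (y0 x); first by symmetry; apply: Eg.
  by rewrite (E_y0 _ _ xx); apply: Eg.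
exists g; split=> //.
- move=> x x' e; have xx : E x x' by apply: gE; rewrite e; reflexivity.
  apply: (class_rank_inj cberE cberF EF enumF xx).
  by have [_ <-] := NP x; have [_ <-] := NP x'; rewrite -/(g x) -/(g x') e.
- move=> B bB; apply: (sigma_fun_comp sX (P := fun n x => B (sg' n (y0 x))) SN) => n.
  apply: (sigma_fun_comp sX (P := fun r x => B (sg' n (sg' r (Phi x)))) Sh) => r.
  exact: (bPhi _ (bsg' r _ (bsg' n _ bB))).
- move=> x x'; split; last exact: gF.
  move=> xx; transitivity (Phi x); first by symmetry.
  by rewrite (PhiF _ _ xx).
Qed.

End Embedding.

Theorem theorem5p4 (R : realType) (X Y : standardBorelType R)
    (E F : X -> X -> Prop) (E' F' : Y -> Y -> Prop)
    (cberE : cber E) (cberF : cber F) (smoothE : smooth E) (smoothF : smooth F)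
    (EF : forall x y, E x y -> F x y)
    (cberE' : cber E') (cberF' : cber F') (smoothE' : smooth E') (smoothF' : smooth F')
    (EF' : forall x y, E' x y -> F' x y) :
  (pair_embeds E F E' F' <-> gcs_le E F E' F') /\
  (pair_biembeddable E F E' F' <-> gcs_eq E F E' F').
Proof.
have [fE bfE fEP] := smooth_baire smoothE; have [fE' bfE' fEP'] := smooth_baire smoothE'.
have [fF bfF fFP] := smooth_baire smoothF; have [fF' bfF' fFP'] := smooth_baire smoothF'.
have [nu [sg enumF]] := smooth_class_enum cberF smoothF.
have [nu' [sg' enumF']] := smooth_class_enum cberF' smoothF'.
have [eqE _ _] := cberE; have [eqF _ _] := cberF.
have [eqE' _ _] := cberE'; have [eqF' _ _] := cberF'.
have embeds : pair_embeds E F E' F' <-> gcs_le E F E' F'.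
  split=> [[f [fi _ fE1 fF1]] W WU|].
    apply: (shape_classes_embed (f := f)) => //.
    exact: (lcs_Sc cberE' cberF' EF' enumF').
  exact: (embedding_of_gcs_le cberE cberF EF cberE' cberF' EF' bfE fEP bfF fFP bfE' fEP'
    enumF enumF').
have embeds' : pair_embeds E' F' E F <-> gcs_le E' F' E F.
  split=> [[f [fi _ fE1 fF1]] W WU|].
    apply: (shape_classes_embed (f := f)) => //.
    exact: (lcs_Sc cberE cberF EF enumF).
  exact: (embedding_of_gcs_le cberE' cberF' EF' cberE cberF EF bfE' fEP' bfF' fFP' bfE fEP
    enumF' enumF).
split=> //; split.
  move=> [/embeds le1 /embeds' le2] W WU.
  by rewrite card_eq_le le1 // le2.
move=> geq; split; [apply/embeds|apply/embeds'] => W WU; have := geq W WU;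
  by rewrite card_eq_le => /andP[].
Qed.
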